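(* Let $U_j(x)$ denote the $j$-th Chebyshev polynomial of the second kind, let $i=\sqrt{-1}$, and let $\xi_{h,d}:=\cos\left(\frac{h\pi}{2d+1}\right)$ for all integers $h$ and $d$. Then for all integers $m,n\geq 1$, the following four numbers are equal: (1) the number of symmetric recurrents on the sandpile grid graph $\mathrm{S}\Gamma_{2m\times 2n}$; (2) the number of domino tilings of a $2m\times 2n$ checkerboard; (3) $(-1)^{mn}\prod_{h=1}^m U_{2n}(i\,\xi_{h,m})$; (4) $\prod_{h=1}^{m}\prod_{k=1}^{n}\left(4\,\xi_{h,m}^2+4\,\xi_{k,n}^2\right)$.
   Context: Chebyshev polynomials of the second kind: $U_0(x)=1$, $U_1(x)=2x$, $U_j(x)=2x\,U_{j-1}(x)-U_{j-2}(x)$ for $j\ge 2$. Grid graph: for integers $p,q\ge1$, $\Gamma_{p\times q}$ is the undirected graph with vertex set $[p]\times[q]$ and edges $\{(a,b),(a',b')\}$ with $|a-a'|+|b-b'|=1$. The sandpile grid graph $\mathrm{S}\Gamma_{p\times q}$ is obtained from $\Gamma_{p\times q}$ by adding a new vertex $s$ (the sink) and, for each grid vertex $v$, an edge between $v$ and $s$ of weight $4-\deg_{\Gamma_{p\times q}}(v)$ (no edge if this is $0$), so that every non-sink vertex has total degree $4$. Recurrents: a configuration on $\mathrm{S}\Gamma_{p\times q}$ is a function $c\colon[p]\times[q]\to\mathbb{N}=\{0,1,2,\dots\}$. A vertex $v$ is unstable in $c$ if $c_v\ge4$; firing an unstable $v$ subtracts $4$ from $c_v$ and adds $1$ to $c_w$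 for each neighbor $w$ of $v$ in $\Gamma_{p\times q}$. Repeatedly firing unstable vertices always leads, after finitely many steps, to a stable configuration (one with no unstable vertices) $c^\circ$ that depends only on $c$. A configuration $c$ is recurrent if it is stable and for every configuration $a$ there is a configuration $b$ with $(a+b)^\circ=c$. A symmetric recurrent on $\mathrm{S}\Gamma_{p\times q}$ is a recurrent configuration $c$ such that $c_{(a,b)}=c_{(a,q-b+1)}=c_{(p-a+1,b)}$ for all $(a,b)\in[p]\times[q]$. Tilings: a $p\times q$ checkerboard is a $p\times q$ rectangular array of squares; a domino is a $1\times2$ or $2\times1$ array of squares; a domino tiling covers every square with non-overlapping dominos. Domino tilings of the $p\times q$ checkerboard are identified with perfect matchings of $\Gamma_{p\times q}$. *)

(* Defs.v *)
From mathcomp Require Import all_boot all_order all_algebra.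
From mathcomp Require Import zify.
From mathcomp Require Import all_classical all_reals all_analysis.
From mathcomp Require Import complex.

Set Implicit Arguments.
Unset Strict Implicit.
Unset Printing Implicit Defensive.

Import Order.TTheory GRing.Theory Num.Theory.

Local Open Scope nat_scope.

(* The cell (a, b) of [p] x [q] is encoded with coordinates starting at 0. *)
Notation cell p q := ('I_p * 'I_q)%type.

Definition grid_adj (p q : nat) (v w : cell p q) : bool :=
  `|v.1 - w.1| + `|v.2 - w.2| == 1.

Definition grid_degree (p q : nat) (v : cell p q) : nat :=
  #|[pred w | grid_adj v w]|.

(* Edge weights of the sandpile grid graph: its vertices are the cells [Some v]
   and the sink [None]; weight 0 means that there is no edge.  The subtraction
   is never truncated, by [grid_degree_le4]. *)
Definition sandpile_weight (p q : nat) (x y : option (cell p q)) : nat :=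
  match x, y with
  | Some v, Some w => grid_adj v w
  | Some v, None | None, Some v => 4 - grid_degree v
  | None, None => 0
  end.

Definition sandpile_degree (p q : nat) (v : cell p q) : nat :=
  \sum_(y : option (cell p q)) sandpile_weight (Some v) y.

Lemma grid_degree_le4 (p q : nat) (v : cell p q) : grid_degree v <= 4.
Proof.
pose f (w : cell p q) : bool * bool :=
  (v.1 == w.1 :> nat, (v.1 <= w.1) && (v.2 <= w.2)).
rewrite /grid_degree -(card_in_image (f := f)).
  by rewrite (leq_trans (max_card _)) // card_prod card_bool.
move=> [a b] [c d]; rewrite !inE /grid_adj /f /= => h1 h2 [e1 e2].
by congr pair; apply: val_inj => /=; move: e1 e2 h1 h2; lia.
Qed.

Lemma sandpile_degreeE (p q : nat) (v : cell p q) : sandpile_degree v = 4.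
Proof.
have le4 := grid_degree_le4 v.
have -> : sandpile_degree v = (4 - grid_degree v) + \sum_w grid_adj v w.
  rewrite /sandpile_degree (bigD1 None) //= (reindex_omap Some id) => [|[]//].
  by rewrite (eq_bigl predT) // => w; rewrite /= eqxx.
have -> : \sum_w grid_adj v w = grid_degree v.
  by rewrite /grid_degree -sum1_card [RHS]big_mkcond.
exact: subnK.
Qed.

(* A configuration records the sand on the non-sink vertices only. *)
Definition config (p q : nat) : Type := {ffun cell p q -> nat}.

Definition add_config (p q : nat) (a b : config p q) : config p q :=
  [ffun v => a v + b v].

Definition unstable (p q : nat) (c : config p q) (v : cell p q) : bool :=
  sandpile_degree v <= c v.

Definition stable (p q : nat) (c : config p q) : Prop :=
  forall v : cell p q, ~~ unstable c v.

Definition fire (p q : nat) (c : config p q) (v : cell p q) : config p q :=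
  [ffun w => c w - (if w == v then sandpile_degree v else 0)
             + sandpile_weight (Some v) (Some w)].

Inductive fires_to (p q : nat) (c : config p q) : config p q -> Prop :=
| fires_to_refl : fires_to c c
| fires_to_step (d : config p q) (v : cell p q) :
    fires_to c d -> unstable d v -> fires_to c (fire d v).

(* [stabilizes_to c d] is the relation d = c°. *)
Definition stabilizes_to (p q : nat) (c d : config p q) : Prop :=
  fires_to c d /\ stable d.

Definition recurrent (p q : nat) (c : config p q) : Prop :=
  stable c /\
  forall a : config p q, exists b : config p q, stabilizes_to (add_config a b) c.

(* [rev_ord] is the reflection a |-> p - a + 1 in 0-based coordinates. *)
Definition symmetric_config (p q : nat) (c : config p q) : Prop :=
  forall (a : 'I_p) (b : 'I_q),
    c (a, b) = c (a, rev_ord b) /\ c (a, b) = c (rev_ord a, b).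

Definition symmetric_recurrent (p q : nat) (c : config p q) : Prop :=
  recurrent c /\ symmetric_config c.

Definition horizontal_pair (p q : nat) (v w : cell p q) : bool :=
  (w.1 == v.1 :> nat) && (w.2 == v.2.+1 :> nat).

Definition vertical_pair (p q : nat) (v w : cell p q) : bool :=
  (w.1 == v.1.+1 :> nat) && (w.2 == v.2 :> nat).

Definition is_domino (p q : nat) (D : {set cell p q}) : bool :=
  [exists v, exists w,
    (horizontal_pair v w || vertical_pair v w) && (D == [set v; w]%SET)].

Definition domino_tiling (p q : nat) (P : {set {set cell p q}}) : bool :=
  finset.partition P [set: cell p q]%SET && [forall D in P, is_domino D].

Definition num_domino_tilings (p q : nat) : nat :=
  #|[pred P : {set {set cell p q}} | domino_tiling P]|.

Local Open Scope ring_scope.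

Fixpoint chebyshevU (A : comNzRingType) (j : nat) {struct j} : {poly A} :=
  match j with
  | 0%N => 1
  | j1.+1 =>
      match j1 with
      | 0%N => 2 *: 'X
      | j2.+1 => 2 *: 'X * chebyshevU A j1 - chebyshevU A j2
      end
  end.

Definition xi (R : realType) (h d : int) : R :=
  cos (h%:~R * pi / (2 * d + 1)%:~R).

(* Main.v *)
(* Both counts equal the determinant of p_n(B), where B is the m x m matrix of
   the path on m vertices with one free end and p_n is a rescaled Chebyshev
   polynomial, p_{j+1} = (X + 2) p_j - p_{j-1}.

   Tilings.  The horizontal dominoes crossing from one column to the next
   describe m non-crossing lattice paths, so the tilings are counted by a
   minor of a product of transfer matrices (Lindstrom-Gessel-Viennot); the
   product obeys the recursion of p_n at B = L L^T, L bidiagonal.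

   Sandpiles.  Stable configurations without forbidden subconfiguration are
   unique in their class modulo the Laplacian, and a large symmetric
   configuration stabilizes to a symmetric one.  Hence the symmetric
   recurrents are the classes of symmetric integer functions modulo the
   Laplacians of symmetric functions.  Folding along both axes and eliminating
   all columns but one identifies this quotient with Z^m / p_n(B) Z^m, which
   has |det p_n(B)| elements by the Smith normal form.

   Products.  U_{2n}(y) = (-1)^n p_n(- 4 y^2), so the roots of p_n are the
   - 4 xi_{k,n}^2, and the eigenvalues of B are the 4 xi_{h,m}^2. *)
Require Import Defs.
From mathcomp Require Import all_boot all_order all_algebra.
From mathcomp Require Import zify ring lra.
From mathcomp Require boolp.

Set Implicit Arguments.
Unset Strict Implicit.
Unset Printing Implicit Defensive.

Import Order.TTheory GRing.Theory Num.Theory.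
Local Open Scope ring_scope.

(** * Column transfer and non-crossing paths *)

(** The reduction of the sandpile quotient to one column is exact over the integers because
    neighbouring columns are coupled with coefficient -1: each column determines the next without
    division, and only the condition at the outer border remains. The matrix [B] arises twice for
    different reasons. For tilings, [L] and [L^T] are the exchanges between odd and even rows; for
    sandpiles, the free end of the path is the central line of the grid, whose mirror neighbour is
    its own copy. The same reflection between columns is the convention [p_{-1} = p_0]. Stabilizing
    must not leave the class modulo Laplacians of symmetric functions. This holds because a maximum
    argument forces the potential between two stable configurations without forbidden
    subconfiguration to vanish, so the potential of a symmetric stabilization is itself symmetric.
    The finiteness of the quotient needs a nonzero determinant, which is read off the positive
    trigonometric product. *)

Lemma det_mulmx_rowsub (R : comNzRingType) (m p : nat)
    (A : 'M[R]_(m, p)) (B : 'M[R]_(p, m)) :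
  \det (A *m B) =
    \sum_(f : {ffun 'I_m -> 'I_p}) (\prod_i A i (f i)) * \det (rowsub f B).
Proof.
(* Row [i] of the product is a combination of the rows of [B], and [f] chooses one of them for each
   [i]. This is Cauchy-Binet before grouping by image. *)
rewrite /determinant.
under eq_bigr => s _.
  under eq_bigr => i _ do rewrite mxE.
  rewrite bigA_distr_bigA /= mulr_sumr.
  over.
rewrite exchange_big; apply: eq_bigr => f _.
rewrite mulr_sumr; apply: eq_bigr => s _.
rewrite big_split mulrCA; congr (_ * (_ * _)).
by apply: eq_bigr => i _; rewrite mxE.
Qed.

(* In each column the cells of row parity [e] are those where a path enters: it
   follows the vertical domino to an adjacent row, or stays in its row to cross
   a horizontal domino.  A path met at the other parity is half way through a
   horizontal domino. *)
Definition moves (e : bool) (r s : nat) : bool :=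
  (if odd r == e then (r <= s.+1) && (s <= r.+1) else s == r)%N.

(** Only adjacent rows could be exchanged, and these have opposite parities, so one of the two paths
    stays in place. Meeting remains possible. *)
Lemma moves_noncrossing (e : bool) (r r' s s' : nat) :
  (r < s)%N -> moves e r r' -> moves e s s' -> (r' <= s')%N.
Proof. by rewrite /moves; case: e; do 2!case: ifP; lia. Qed.

Definition increasing (m p : nat) (f : {ffun 'I_m -> 'I_p}) : bool :=
  [forall i : 'I_m, forall j : 'I_m, (i < j)%N ==> (f i < f j)%N].

Lemma increasingP (m p : nat) (f : {ffun 'I_m -> 'I_p}) :
  reflect (forall i j : 'I_m, (i < j)%N -> (f i < f j)%N) (increasing f).
Proof.
apply: (iffP forallP) => [fP i j|fP i].
  by have /forallP/(_ j)/implyP := fP i.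
by apply/forallP => j; apply/implyP; apply: fP.
Qed.

Lemma increasing_inj (m p : nat) (f : {ffun 'I_m -> 'I_p}) :
  increasing f -> injective f.
Proof.
move=> /increasingP fP i j eqf; apply/val_inj => /=.
by case: (ltngtP i j) => // /fP; rewrite eqf ltnn.
Qed.

Definition move_mx (p : nat) (e : bool) : 'M[int]_p :=
  \matrix_(r, s) (moves e r s)%:R.

Definition moves_to (m p : nat) (e : bool) (f g : {ffun 'I_m -> 'I_p}) : bool :=
  [forall i, moves e (f i) (g i)].

(* The path families counted by a minor never cross, so after a multilinear
   expansion only the order-preserving ones survive, all with sign [+1]. *)
Lemma det_rowsub_move_mx (m p : nat) (e : bool) (f : {ffun 'I_m -> 'I_p})
    (B : 'M[int]_(p, m)) :
  increasing f ->
  \det (rowsub f (move_mx p e *m B)) =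
    \sum_(g | increasing g && moves_to e f g) \det (rowsub g B).
Proof.
move=> /increasingP f_incr.
rewrite -mul_rowsub_mx det_mulmx_rowsub [RHS]big_mkcond; apply: eq_bigr => g _.
case: ifP => [/andP[_ /forallP fg]|].
  by rewrite big1 ?mul1r // => i _; rewrite !mxE fg.
have [fg|] := boolP (moves_to e f g); last first.
  rewrite negb_forall => /existsP[i fgi] _.
  by rewrite (bigD1 i) //= !mxE (negPf fgi) !mul0r.
rewrite andbT => /negbT; rewrite negb_forall => /existsP[i].
rewrite negb_forall => /existsP[j]; rewrite negb_imply -leqNgt => /andP[ij gji].
(* Moves preserve the weak order, so a failure of strict order is a meeting, which repeats a row in
   the minor. *)
have eqg : g i = g j.
  apply/val_inj/anti_leq; rewrite gji andbT.
  exact: (moves_noncrossing (f_incr _ _ ij) (forallP fg i) (forallP fg j)).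
rewrite (determinant_alternate (i1 := i) (i2 := j)) ?mulr0 //.
  by apply/eqP => eqij; rewrite eqij ltnn in ij.
by move=> k; rewrite !mxE eqg.
Qed.

Definition below (p : nat) (v : {set 'I_p}) (a : nat) : bool :=
  [exists b in v, b.+1 == a].

(* [H] holds the cells covered from the previous column, [x.1] the left cells of
   horizontal dominoes and [x.2] the upper cells of vertical ones. *)
Definition column_ok (p : nat) (H : {set 'I_p}) (x : {set 'I_p} * {set 'I_p}) :
    bool :=
  [forall a : 'I_p, (a \in H) + (a \in x.1) + (a \in x.2) + below x.2 a == 1]%N
  && [forall b in x.2, b.+1 < p]%N.

Definition hit (m p : nat) (f : {ffun 'I_m -> 'I_p}) (a : nat) : bool :=
  [exists i, f i == a :> nat].

(** The covered set [H] of [column_ok] read off the path positions: at parity [e] a path enters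
    through a free cell, at the other parity it sits in a domino coming from the previous column. *)
Definition profile (m p : nat) (e : bool) (f : {ffun 'I_m -> 'I_p}) : {set 'I_p} :=
  [set a : 'I_p | (odd a == e) != hit f a].

Definition vertical_moves (m p : nat) (f g : {ffun 'I_m -> 'I_p}) : {set 'I_p} :=
  [set a : 'I_p | [exists i, ((f i == a :> nat) && (g i == a.+1 :> nat))
                   || ((f i == a.+1 :> nat) && (g i == a :> nat))]].

(** Inverse to [vertical_moves]: each entering path follows the vertical domino at its cell. On a
    valid column the default of [insubd] is never taken. *)
Definition advance (m p : nat) (e : bool) (v : {set 'I_p})
    (f : {ffun 'I_m -> 'I_p}) : {ffun 'I_m -> 'I_p} :=
  [ffun i => if odd (f i) == e then
               if f i \in v then insubd (f i) (f i).+1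
               else if below v (f i) then insubd (f i) (f i).-1 else f i
             else f i].

Lemma belowP (p : nat) (v : {set 'I_p}) (a : nat) :
  reflect (exists2 b : 'I_p, b \in v & b.+1 = a) (below v a).
Proof. by apply: (iffP exists_inP) => -[b bv /eqP ba]; exists b => //; apply/eqP. Qed.

Lemma hitP (m p : nat) (f : {ffun 'I_m -> 'I_p}) (a : nat) :
  reflect (exists i, f i = a :> nat) (hit f a).
Proof. by apply: (iffP existsP) => -[i /eqP fi]; exists i => //; apply/eqP. Qed.

Lemma hit_val (m p : nat) (f : {ffun 'I_m -> 'I_p}) (i : 'I_m) : hit f (f i).
Proof. by apply/hitP; exists i. Qed.

Section Column.
Variables (m p : nat) (e : bool) (f : {ffun 'I_m -> 'I_p}).
Hypothesis f_incr : increasing f.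

Section FromColumn.
Variable x : {set 'I_p} * {set 'I_p}.
Hypothesis x_ok : column_ok (profile e f) x.

Let exact_cover (a : 'I_p) :
  (((odd a == e) != hit f a) + (a \in x.1) + (a \in x.2) + below x.2 a = 1)%N.
Proof. by have /andP[/forallP/(_ a)/eqP + _] := x_ok; rewrite inE. Qed.

Let vertical_lt (a : 'I_p) : a \in x.2 -> (a.+1 < p)%N.
Proof. by have /andP[_ /forall_inP +] := x_ok; apply. Qed.

Let below_succ (a b : 'I_p) : b = a.+1 :> nat -> below x.2 b = (a \in x.2).
Proof.
move=> ba; apply/belowP/idP => [[c cv cb]|av]; last by exists a.
by rewrite (_ : a = c) //; apply/val_inj => /=; lia.
Qed.

Let cover_vertical (a : 'I_p) : a \in x.2 ->
  [/\ (a \in x.1) = false, below x.2 a = false & hit f a = (odd a == e)].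
Proof.
move=> av; have := exact_cover a; rewrite av.
by case: (a \in x.1); case: (below _ _); case: (hit _ _); case: (_ == e).
Qed.

Let cover_below (a : 'I_p) : below x.2 a ->
  [/\ (a \in x.1) = false, (a \in x.2) = false & hit f a = (odd a == e)].
Proof.
move=> av; have := exact_cover a; rewrite av.
by case: (a \in x.1); case: (a \in x.2); case: (hit _ _); case: (_ == e).
Qed.

Let cover_horizontal (a : 'I_p) : a \in x.1 ->
  [/\ (a \in x.2) = false, below x.2 a = false & hit f a = (odd a == e)].
Proof.
move=> av; have := exact_cover a; rewrite av.
by case: (below _ _); case: (a \in x.2); case: (hit _ _); case: (_ == e).
Qed.

Let uncovered (a : 'I_p) : (a \in x.2) = false -> below x.2 a = false ->
  (a \in x.1) = false -> hit f a = (odd a != e).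
Proof.
move=> av ab ah; have := exact_cover a; rewrite av ab ah.
by case: (hit _ _); case: (_ == e).
Qed.

Lemma advanceE (i : 'I_m) :
  advance e x.2 f i =
    (if odd (f i) == e then
       if f i \in x.2 then (f i).+1
       else if below x.2 (f i) then (f i).-1 else f i
     else f i) :> nat.
Proof.
rewrite ffunE; case: ifP => // _; case: ifP => [/vertical_lt lt|_].
  by rewrite val_insubd lt.
case: ifP => // /belowP[b _ bf]; rewrite val_insubd.
by rewrite (leq_ltn_trans (leq_pred _)).
Qed.

Lemma advance_moves : moves_to e f (advance e x.2 f).
Proof.
apply/forallP => i; rewrite /moves advanceE.
by case: (odd (f i) == e); rewrite ?eqxx //; case: ifP => _; [|case: ifP => _]; lia.
Qed.

(** The order is weakly preserved, so only a meeting has to be excluded: at the common cell a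
    vertical domino would overlap a second vertical one or the horizontal one that the other path
    follows. *)
Lemma advance_increasing : increasing (advance e x.2 f).
Proof.
apply/increasingP => i j ij.
have fij : (f i < f j)%N by move/increasingP: f_incr; apply.
rewrite ltn_neqAle (moves_noncrossing fij (forallP advance_moves i)
                      (forallP advance_moves j)) andbT.
apply/eqP; rewrite !advanceE.
have bs := @below_succ (f i) (f j); clear ij.
have [oi|oi] := boolP (odd (f i) == e);
  have [oj|oj] := boolP (odd (f j) == e).
- have oij : odd (f i) = odd (f j) by rewrite (eqP oi) (eqP oj).
  case: ifP => vi; last by do ?[case: ifP => _]; clear -fij oij; lia.
  case: ifP => vj; first by lia.
  case: ifP => bj; last by lia.
  move=> eq_ij; have fjb : ((f j).-1 < p)%N by rewrite (leq_ltn_trans (leq_pred _)).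
  have bv : Ordinal fjb \in x.2 by rewrite -(@below_succ _ (f j)) //=; lia.
  have [_ + _] := cover_vertical bv.
  by rewrite (@below_succ (f i)) ?vi //=; lia.
- case: ifP => vi; last by case: ifP => _; lia.
  move=> eq_ij; have := bs (esym eq_ij); rewrite vi => /cover_below[_ _].
  by rewrite hit_val (negPf oj).
- case: ifP => vj; first by lia.
  case: ifP => bj; last by lia.
  move=> eq_ij; have /bs eqb : f j = (f i).+1 :> nat by lia.
  move: bj; rewrite eqb => /cover_vertical[_ _].
  by rewrite hit_val (negPf oi).
- by lia.
Qed.

(** Horizontal dominoes starting in rows of parity [e] are the ones followed by a path. Those
    starting in the other rows carry none, and every other cell of these rows receives a path. *)
Lemma hit_advance (a : 'I_p) :
  hit (advance e x.2 f) a = ((odd a == e) == (a \in x.1)).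
Proof.
have [oa|oa] := boolP (odd a == e); rewrite ?eqTb ?eqFb.
  apply/hitP/idP => [[i]|/cover_horizontal[av ab]].
    rewrite advanceE; case: ifP => oi; last by lia.
    case: ifP => [_|iv]; first by lia.
    case: ifP => [/belowP[c _] bi|bi /val_inj <-]; first by lia.
    have [//|/negbTE/(uncovered iv bi)] := boolP (f i \in x.1).
    by rewrite hit_val oi.
  rewrite oa => /hitP[i ia].
  by exists i; rewrite advanceE (val_inj ia) oa av ab.
apply/hitP/negP => [[i]|ah].
  rewrite advanceE; case: ifP => oi; last first.
    move=> /val_inj <- /cover_horizontal[_ _].
    by rewrite hit_val oi.
  case: ifP => [iv fa /cover_horizontal[_ + _]|_].
    by rewrite (below_succ (esym fa)) iv.
  case: ifP => [bi fa /cover_horizontal[+ _ _]|_ fa]; last by lia.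
  have /below_succ <- : f i = a.+1 :> nat by move/belowP: bi => [c _]; lia.
  by rewrite bi.
have [/hitP[i ia]|ha] := boolP (hit f a).
  by exists i; rewrite advanceE ia (negPf oa).
have [av|/negbTE na] := boolP (a \in x.2).
  have lt := vertical_lt av; pose b := Ordinal lt.
  have bE : below x.2 b by rewrite (@below_succ a).
  have ob : odd b == e by rewrite /b /=; lia.
  have [_ bv] := cover_below bE; rewrite ob => /hitP[i ib].
  by exists i; rewrite advanceE (val_inj ib) bE bv ob.
have [/belowP[b bv ba]|/negbTE nb] := boolP (below x.2 a).
  have ob : odd b == e by clear -ba oa; lia.
  have [_ _] := cover_vertical bv; rewrite ob => /hitP[i ib].
  by exists i; rewrite advanceE (val_inj ib) bv ob.
by move: (uncovered na nb (negbTE (introN idP ah))); rewrite (negPf ha) oa.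
Qed.

Lemma profile_advance : profile (~~ e) (advance e x.2 f) = x.1.
Proof.
apply/setP => a; rewrite inE hit_advance.
by case: (odd a); case: (e); case: (a \in x.1).
Qed.

Lemma vertical_advance : vertical_moves f (advance e x.2 f) = x.2.
Proof.
apply/setP => a; rewrite inE; apply/existsP/idP => [[i]|av].
  rewrite advanceE => /orP[]/andP[/eqP ia].
    have /val_inj <- := ia.
    by case: ifP => _; [case: ifP => // _; [case: ifP => _]|]; clear ia; lia.
  rewrite -(below_succ ia).
  by case: ifP => _; [case: ifP => _; [|case: ifP => //]|]; lia.
have lt := vertical_lt av; pose b := Ordinal lt.
have bE : below x.2 b by rewrite (@below_succ a).
have [oa|oa] := boolP (odd a == e).
  have [_ _] := cover_vertical av; rewrite oa => /hitP[i ia].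
  by exists i; rewrite advanceE (val_inj ia) oa av !eqxx.
have ob : odd b == e by rewrite /b /=; clear -oa; lia.
have [_ bv] := cover_below bE; rewrite ob => /hitP[i ib].
exists i; rewrite advanceE (val_inj ib) bE bv ob /=; apply/orP; right.
by rewrite !eqxx.
Qed.
End FromColumn.

Section ToColumn.
Variable g : {ffun 'I_m -> 'I_p}.
Hypotheses (g_incr : increasing g) (fg : moves_to e f g).

Let fgE (i : 'I_m) : moves e (f i) (g i).
Proof. exact: (forallP fg). Qed.

Let f_inj (i j : 'I_m) : f i = f j :> nat -> i = j.
Proof. by move=> /val_inj/(increasing_inj f_incr). Qed.

Let g_inj (i j : 'I_m) : g i = g j :> nat -> i = j.
Proof. by move=> /val_inj/(increasing_inj g_incr). Qed.

Lemma vertical_movesP (a : 'I_p) :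
  reflect (exists i, f i = a :> nat /\ g i = a.+1 :> nat \/
                     f i = a.+1 :> nat /\ g i = a :> nat)
          (a \in vertical_moves f g).
Proof.
rewrite inE; apply: (iffP existsP) => -[i fi]; exists i.
  by case/orP: fi => /andP[/eqP ? /eqP ?]; [left|right].
by case: fi => -[-> ->]; rewrite !eqxx ?orbT.
Qed.

Lemma below_vertical_moves (a : nat) :
  reflect (exists i, f i = a :> nat /\ g i = a.-1 :> nat /\ (0 < a)%N \/
                     (f i).+1 = a :> nat /\ g i = a :> nat)
          (below (vertical_moves f g) a).
Proof.
apply: (iffP (belowP _ _)) => [[b /vertical_movesP[i fi] ba]|[i fi]].
  by exists i; lia.
have lt : (a.-1 < p)%N by have [? ?] := (ltn_ord (f i), ltn_ord (g i)); lia.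
exists (Ordinal lt); last by rewrite /=; lia.
by apply/vertical_movesP; exists i => /=; lia.
Qed.

Lemma advance_vertical_moves : advance e (vertical_moves f g) f = g.
Proof.
apply/ffunP => i; rewrite ffunE; have := fgE i; rewrite /moves.
case: ifP => [oi|oi /eqP/val_inj //] mv.
have [/vertical_movesP[j jE]|iv] := boolP (_ \in _).
  have := fgE j; rewrite /moves; case: ifP => oj mj; last by lia.
  have ji : j = i by apply: f_inj; lia.
  by apply/val_inj; rewrite val_insubd /= -ji; have := ltn_ord (g j); case: ifP; lia.
have [/below_vertical_moves[j jE]|ib] := boolP (below _ _).
  have := fgE j; rewrite /moves; case: ifP => oj mj; last by lia.
  have ji : j = i by apply: f_inj; lia.
  by apply/val_inj; rewrite val_insubd /= -ji; have := ltn_ord (g j); case: ifP; lia.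
apply/val_inj/eqP/negPn/negP => /= ne.
have [lt|gt] : (g i = (f i).+1 :> nat) \/ ((g i).+1 = f i) by lia.
  by case/vertical_movesP: iv; exists i; lia.
by case/below_vertical_moves: ib; exists i; lia.
Qed.

(** In a row of parity [e] only the path standing there before the move affects the cell, in the
    other rows only the one standing there after it. The cover count thus depends on a single
    path. *)
Lemma moves_column_ok :
  column_ok (profile e f) (profile (~~ e) g, vertical_moves f g).
Proof.
apply/andP; split; last first.
  apply/forall_inP => a /vertical_movesP[i iE].
  by have [? ?] := (ltn_ord (f i), ltn_ord (g i)); lia.
apply/forallP => a; rewrite /= [a \in profile e f]inE [a \in profile _ g]inE.
have [oa|oa] := boolP (odd a == e).
  have [/hitP[i ia]|/hitP nf] := boolP (hit f a); last first.
    have -> : hit g a = false.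
      apply/hitP => -[j ja]; apply: nf; exists j.
      by have := fgE j; rewrite /moves; case: ifP; lia.
    have -> : (a \in vertical_moves f g) = false.
      apply/vertical_movesP => -[j jE]; apply: nf; exists j.
      by have := fgE j; rewrite /moves; case: ifP; lia.
    have -> : below (vertical_moves f g) a = false.
      apply/below_vertical_moves => -[j jE]; apply: nf; exists j.
      by have := fgE j; rewrite /moves; case: ifP; lia.
    by rewrite (eqP oa); case: (e).
  have -> : hit g a = (g i == a :> nat).
    apply/hitP/eqP => [[j ja]|]; last by exists i.
    rewrite -ja; congr (nat_of_ord (g _)); apply: f_inj.
    by have := fgE j; rewrite /moves; case: ifP; lia.
  have -> : (a \in vertical_moves f g) = (g i == a.+1 :> nat).
    apply/vertical_movesP/eqP => [[j jE]|]; last by exists i; left.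
    have ji : j = i.
      by apply: f_inj; have := fgE j; rewrite /moves; case: ifP; lia.
    by rewrite ji in jE; lia.
  have -> : below (vertical_moves f g) a = ((g i).+1 == a :> nat).
    apply/below_vertical_moves/eqP => [[j jE]|]; last by exists i; lia.
    have ji : j = i.
      by apply: f_inj; have := fgE j; rewrite /moves; case: ifP; lia.
    by rewrite ji in jE; lia.
  by have := fgE i; rewrite /moves ia oa; lia.
have [/hitP[i ia]|/hitP ng] := boolP (hit g a); last first.
  have -> : hit f a = false.
    apply/hitP => -[j ja]; apply: ng; exists j.
    by have := fgE j; rewrite /moves; case: ifP; lia.
  have -> : (a \in vertical_moves f g) = false.
    apply/vertical_movesP => -[j jE]; apply: ng; exists j.
    by have := fgE j; rewrite /moves; case: ifP; lia.
  have -> : below (vertical_moves f g) a = false.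
    apply/below_vertical_moves => -[j jE]; apply: ng; exists j.
    by have := fgE j; rewrite /moves; case: ifP; lia.
  by lia.
have -> : hit f a = (f i == a :> nat).
  apply/hitP/eqP => [[j ja]|]; last by exists i.
  rewrite -ja; congr (nat_of_ord (f _)); apply: g_inj.
  by have := fgE j; rewrite /moves; case: ifP; lia.
have -> : (a \in vertical_moves f g) = (f i == a.+1 :> nat).
  apply/vertical_movesP/eqP => [[j jE]|]; last by exists i; right.
  have ji : j = i.
    by apply: g_inj; have := fgE j; rewrite /moves; case: ifP; lia.
  by rewrite ji in jE; lia.
have -> : below (vertical_moves f g) a = ((f i).+1 == a :> nat).
  apply/below_vertical_moves/eqP => [[j jE]|]; last by exists i; lia.
  have ji : j = i.
    by apply: g_inj; have := fgE j; rewrite /moves; case: ifP; lia.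
  by rewrite ji in jE; lia.
by have := fgE i; rewrite /moves; case: ifP; lia.
Qed.
End ToColumn.

(** Given [f], a filling of the column and the positions [g] after it determine each other, by
    [advance] in one direction and by [profile] with [vertical_moves] in the other. *)
Lemma reindex_columns (F : {set 'I_p} -> nat) :
  (\sum_(x | column_ok (profile e f) x) F x.1 =
   \sum_(g | increasing g && moves_to e f g) F (profile (~~ e) g))%N.
Proof.
rewrite (reindex_onto (fun g => (profile (~~ e) g, vertical_moves f g))
                      (fun x => advance e x.2 f)) /=; last first.
  by move=> x x_ok; rewrite profile_advance // vertical_advance //; case: (x).
apply: eq_bigl => g; apply/andP/andP => [[x_ok /eqP <-]|[g_incr fg]].
  by rewrite (advance_increasing x_ok) (advance_moves x_ok).
by rewrite moves_column_ok // advance_vertical_moves.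
Qed.
End Column.

(** * Minors of the transfer product *)

Fixpoint completions (p k : nat) (H : {set 'I_p}) : nat :=
  if k is k'.+1 then (\sum_(x | column_ok H x) completions k' x.1)%N
  else (H == set0).

(** With [k] columns left the entering parity is [odd k]. The columns of the matrix index the even
    rows, where every path has to end. *)
Fixpoint path_mx (m k : nat) : 'M[int]_(2 * m, m) :=
  if k is k'.+1 then move_mx (2 * m) (odd k) *m path_mx m k'
  else \matrix_(r, i) (r == (2 * i)%N :> nat)%:R.

Lemma two_mul_ord (m : nat) (i : 'I_m) : (2 * i < 2 * m)%N.
Proof. by rewrite ltn_pmul2l. Qed.

Definition even_rows (m : nat) : {ffun 'I_m -> 'I_(2 * m)} :=
  [ffun i => Ordinal (two_mul_ord i)].

Lemma even_rows_increasing (m : nat) : increasing (even_rows m).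
Proof. by apply/increasingP => i j ij; rewrite !ffunE /= ltn_pmul2l. Qed.

Lemma hit_even_rows (m : nat) (a : 'I_(2 * m)) : hit (even_rows m) a = ~~ odd a.
Proof.
apply/hitP/idP => [[i]|oa]; first by rewrite ffunE /=; lia.
have lt : (a./2 < m)%N by have := ltn_ord a; lia.
by exists (Ordinal lt); rewrite ffunE /=; lia.
Qed.

(** Distinct even rows leave no freedom here: each position is bounded below by counting from the
    first path and above by counting from the last. *)
Lemma increasing_even (m : nat) (f : {ffun 'I_m -> 'I_(2 * m)}) :
  increasing f -> (forall i, ~~ odd (f i)) -> f = even_rows m.
Proof.
move=> /increasingP f_incr f_even; apply/ffunP => i; rewrite ffunE.
apply/val_inj => /=.
have lower k (ltk : (k < m)%N) : (2 * k <= f (Ordinal ltk))%N.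
  elim: k ltk => // k IHk ltk; have ltk' := ltnW ltk.
  have := f_incr (Ordinal ltk') (Ordinal ltk) (ltnSn k).
  have [[? ?] ?] := (IHk ltk', f_even (Ordinal ltk'), f_even (Ordinal ltk)).
  by lia.
have upper k (ltk : (m - k.+1 < m)%N) :
    (k < m -> f (Ordinal ltk) <= 2 * (m - k.+1))%N.
  elim: k ltk => [|k IHk] ltk km.
    by have [? ?] := (ltn_ord (f (Ordinal ltk)), f_even (Ordinal ltk)); lia.
  have ltk' : (m - k.+1 < m)%N by lia.
  have := f_incr (Ordinal ltk) (Ordinal ltk').
  have [[? ?] ?] := (IHk ltk' (ltnW km), f_even (Ordinal ltk'), f_even (Ordinal ltk)).
  by rewrite /=; lia.
have := lower i (ltn_ord i).
have lti : (m - (m - i.+1).+1 < m)%N by have := ltn_ord i; lia.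
have := upper (m - i.+1)%N lti.
rewrite (_ : Ordinal lti = i); last by apply/val_inj => /=; have := ltn_ord i; lia.
rewrite (_ : Ordinal (ltn_ord i) = i); last exact/val_inj.
by have := ltn_ord i; lia.
Qed.

(** Filling the next column and expanding the minor range over the same families [g]. With no column
    left, an odd position means both a domino sticking out of the board and a zero row in the
    minor. *)
Lemma completions_det (m k : nat) (f : {ffun 'I_m -> 'I_(2 * m)}) :
  increasing f ->
  (completions k (profile (odd k) f))%:Z = \det (rowsub f (path_mx m k)).
Proof.
elim: k f => [|k IHk] f f_incr /=.
  have [/forallP f_even|] := boolP [forall i, ~~ odd (f i)].
    rewrite (increasing_even f_incr f_even).
    have -> : profile false (even_rows m) = set0.
      by apply/setP => a; rewrite !inE hit_even_rows; lia.
    rewrite eqxx; suff -> : rowsub (even_rows m) (\matrix_(r, i)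
      (r == (2 * i)%N :> nat)%:R) = 1%:M :> 'M[int]_m by rewrite det1.
    by apply/matrixP => i j; rewrite !mxE ffunE /= eqn_pmul2l.
  rewrite negb_forall => /existsP[i]; rewrite negbK => fi_odd.
  have -> : (profile false f == set0) = false.
    by apply/eqP => /setP/(_ (f i)); rewrite !inE hit_val fi_odd.
  rewrite (expand_det_row _ i) big1 // => j _.
  by rewrite !mxE (_ : _ == _ = false) ?mul0r //; lia.
rewrite det_rowsub_move_mx // reindex_columns // (big_morph Posz PoszD (erefl 0%:Z)).
by apply: eq_bigr => g /andP[g_incr _]; rewrite negbK IHk.
Qed.

(** * Domino tilings as sequences of columns *)

Section Tilings.
Local Open Scope nat_scope.
Variables p q : nat.
Implicit Types (v w : cell p q) (P : {set {set cell p q}}) (h g : pred (cell p q)).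

Definition horizontal_domino v : {set cell p q} :=
  [set w | (w == v) || horizontal_pair v w].

Definition vertical_domino v : {set cell p q} :=
  [set w | (w == v) || vertical_pair v w].

(** A tiling encoded by the left cells [h] of its horizontal dominoes and the upper cells [g] of its
    vertical ones, a form that splits by columns. *)
Definition exact_cover h g : Prop :=
  [/\ forall v, h v + [exists w, horizontal_pair w v && h w]
                + g v + [exists w, vertical_pair w v && g w] = 1,
      forall v, h v -> v.2.+1 < q
    & forall v, g v -> v.1.+1 < p].

Definition horizontal_of P : pred (cell p q) :=
  fun v => (v.2.+1 < q) && (horizontal_domino v \in P).

Definition vertical_of P : pred (cell p q) :=
  fun v => (v.1.+1 < p) && (vertical_domino v \in P).

Definition tiling_of h g : {set {set cell p q}} :=
  [set D | [exists v, h v && (D == horizontal_domino v)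
                      || g v && (D == vertical_domino v)]].

Lemma cell_eqP v w : reflect (v.1 = w.1 :> nat /\ v.2 = w.2 :> nat) (v == w).
Proof.
case: v w => [a b] [c d]; apply: (iffP eqP) => [[-> ->]//|/= [ac bd]].
by congr pair; apply: val_inj.
Qed.

Lemma mem_horizontal_domino v w :
  (w \in horizontal_domino v) = (w == v) || horizontal_pair v w.
Proof. by rewrite inE. Qed.

Lemma mem_vertical_domino v w :
  (w \in vertical_domino v) = (w == v) || vertical_pair v w.
Proof. by rewrite inE. Qed.

Lemma horizontal_pair_uniq v w w' :
  horizontal_pair w v -> horizontal_pair w' v -> w = w'.
Proof. by rewrite /horizontal_pair => ? ?; apply/eqP/cell_eqP; lia. Qed.

Lemma vertical_pair_uniq v w w' :
  vertical_pair w v -> vertical_pair w' v -> w = w'.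
Proof. by rewrite /vertical_pair => ? ?; apply/eqP/cell_eqP; lia. Qed.

Lemma horizontal_domino_set2 v w :
  horizontal_pair v w -> horizontal_domino v = [set v; w].
Proof.
move=> vw; apply/setP => u; rewrite !inE; congr (_ || _).
apply/idP/cell_eqP; move: vw; rewrite /horizontal_pair; lia.
Qed.

Lemma vertical_domino_set2 v w :
  vertical_pair v w -> vertical_domino v = [set v; w].
Proof.
move=> vw; apply/setP => u; rewrite !inE; congr (_ || _).
apply/idP/cell_eqP; move: vw; rewrite /vertical_pair; lia.
Qed.

Lemma horizontal_pair_lt v w : horizontal_pair v w -> v.2.+1 < q.
Proof. by move=> /andP[_ /eqP <-]. Qed.

Lemma vertical_pair_lt v w : vertical_pair v w -> v.1.+1 < p.
Proof. by move=> /andP[/eqP <- _]. Qed.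

Lemma horizontal_pair_neq v w : horizontal_pair w v -> w <> v.
Proof. by move=> + wv; rewrite wv /horizontal_pair; lia. Qed.

Lemma vertical_pair_neq v w : vertical_pair w v -> w <> v.
Proof. by move=> + wv; rewrite wv /vertical_pair; lia. Qed.

Lemma horizontal_next v : v.2.+1 < q -> exists w, horizontal_pair v w.
Proof. by move=> lt; exists (v.1, Ordinal lt); rewrite /horizontal_pair !eqxx. Qed.

Lemma vertical_next v : v.1.+1 < p -> exists w, vertical_pair v w.
Proof. by move=> lt; exists (Ordinal lt, v.2); rewrite /vertical_pair !eqxx. Qed.

Lemma horizontal_domino_inj : injective horizontal_domino.
Proof.
move=> v w vw; have vw' : v \in horizontal_domino w by rewrite -vw inE eqxx.
have wv' : w \in horizontal_domino v by rewrite vw inE eqxx.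
move: vw' wv'; rewrite !inE => /predU1P[//|+] /predU1P[//|].
by rewrite /horizontal_pair; lia.
Qed.

Lemma vertical_domino_inj : injective vertical_domino.
Proof.
move=> v w vw; have vw' : v \in vertical_domino w by rewrite -vw inE eqxx.
have wv' : w \in vertical_domino v by rewrite vw inE eqxx.
move: vw' wv'; rewrite !inE => /predU1P[//|+] /predU1P[//|].
by rewrite /vertical_pair; lia.
Qed.

Lemma horizontal_vertical_neq v w :
  v.2.+1 < q -> horizontal_domino v <> vertical_domino w.
Proof.
move=> /horizontal_next[u vu] eqD.
have col z : z \in vertical_domino w -> z.2 = w.2 :> nat.
  by rewrite inE /vertical_pair => /orP[/eqP ->//|/andP[_ /eqP]].
have := col v; have := col u; rewrite -eqD !inE eqxx vu orbT.
move=> /(_ isT) uw /(_ isT) vw; move: vu => /andP[_ /eqP uv].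
by move: vw; rewrite -uw uv => /n_Sn.
Qed.

Lemma is_dominoP (D : {set cell p q}) :
  reflect (exists v, v.2.+1 < q /\ D = horizontal_domino v \/
                     v.1.+1 < p /\ D = vertical_domino v) (is_domino D).
Proof.
apply: (iffP existsP) => [[v /existsP[w /andP[/orP[vw|vw] /eqP ->]]]|[v [[lt ->]|[lt ->]]]].
- exists v; left; rewrite (horizontal_domino_set2 vw); split=> //.
  exact: horizontal_pair_lt vw.
- exists v; right; rewrite (vertical_domino_set2 vw); split=> //.
  exact: vertical_pair_lt vw.
- have [w vw] := horizontal_next lt; exists v; apply/existsP; exists w.
  by rewrite vw (horizontal_domino_set2 vw) eqxx.
- have [w vw] := vertical_next lt; exists v; apply/existsP; exists w.
  by rewrite vw orbT (vertical_domino_set2 vw) eqxx.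
Qed.

Lemma tiling_of_domino h g (D : {set cell p q}) :
  exact_cover h g -> D \in tiling_of h g -> is_domino D.
Proof.
case=> _ hlt glt; rewrite inE => /existsP[v /orP[/andP[hv /eqP ->]|/andP[gv /eqP ->]]].
  by apply/is_dominoP; exists v; left; rewrite hlt.
by apply/is_dominoP; exists v; right; rewrite glt.
Qed.

Inductive covering h g v (D : {set cell p q}) : Prop :=
| CoverRight of h v & D = horizontal_domino v
| CoverLeft w of horizontal_pair w v & h w & D = horizontal_domino w
| CoverDown of g v & D = vertical_domino v
| CoverUp w of vertical_pair w v & g w & D = vertical_domino w.

Lemma tiling_ofP h g v (D : {set cell p q}) :
  D \in tiling_of h g -> v \in D -> covering h g v D.
Proof.
rewrite inE => /existsP[w /orP[]/andP[hw /eqP ->]].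
  rewrite mem_horizontal_domino => /predU1P[->|wv]; first exact: CoverRight.
  exact: (@CoverLeft h g v _ w).
rewrite mem_vertical_domino => /predU1P[->|wv]; first exact: CoverDown.
exact: (@CoverUp h g v _ w).
Qed.

Lemma exact_cover_uniq h g v (D D' : {set cell p q}) :
  exact_cover h g -> covering h g v D -> covering h g v D' -> D = D'.
Proof.
move=> [/(_ v) + _ _].
have ex1 w : horizontal_pair w v -> h w -> [exists w, horizontal_pair w v && h w].
  by move=> wv hw; apply/existsP; exists w; rewrite wv.
have ex2 w : vertical_pair w v -> g w -> [exists w, vertical_pair w v && g w].
  by move=> wv gw; apply/existsP; exists w; rewrite wv.
move=> + cD cD'; case: cD => [a1 ->|w1 b1 /(ex1 _ b1) a1 ->|a1 ->|w1 b1 /(ex2 _ b1) a1 ->];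
  case: cD' => [a2 ->|w2 b2 /(ex1 _ b2) a2 ->|a2 ->|w2 b2 /(ex2 _ b2) a2 ->];
  rewrite ?a1 ?a2; try by [].
all: try by rewrite (horizontal_pair_uniq b1 b2).
all: try by rewrite (vertical_pair_uniq b1 b2).
all: try case: [exists w, horizontal_pair w v && h w].
all: try case: [exists w, vertical_pair w v && g w].
all: by case: (h v); case: (g v).
Qed.

Lemma tiling_of_tiling h g : exact_cover h g -> domino_tiling (tiling_of h g).
Proof.
move=> hg; apply/andP; split; last first.
  by apply/forallP => D; apply/implyP; exact: tiling_of_domino.
apply/and3P; split.
- apply/eqP/setP => v; rewrite inE; apply/bigcupP.
  have [/(_ v) + _ _] := hg.
  have [hv _|_] := boolP (h v).
    exists (horizontal_domino v); rewrite inE ?eqxx //.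
    by apply/existsP; exists v; rewrite hv eqxx.
  have [/existsP[w /andP[wv hw]] _|_] := boolP [exists w, horizontal_pair w v && h w].
    exists (horizontal_domino w); rewrite inE ?wv ?orbT //.
    by apply/existsP; exists w; rewrite hw eqxx.
  have [gv _|_] := boolP (g v).
    exists (vertical_domino v); rewrite inE ?eqxx //.
    by apply/existsP; exists v; rewrite gv eqxx orbT.
  have [/existsP[w /andP[wv gw]] _|_ //] := boolP [exists w, vertical_pair w v && g w].
  exists (vertical_domino w); rewrite inE ?wv ?orbT //.
  by apply/existsP; exists w; rewrite gw eqxx orbT.
- apply/trivIsetP => D D' DP D'P; apply: contraNT => /pred0Pn[v /andP[/= vD vD']].
  by apply/eqP/(exact_cover_uniq hg); apply: (@tiling_ofP _ _ v).
- apply/negP; rewrite inE => /existsP[v /orP[]/andP[_ /eqP/setP/(_ v)]].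
    by rewrite !inE eqxx.
  by rewrite !inE eqxx.
Qed.

Lemma horizontal_of_tiling_of h g :
  exact_cover h g -> horizontal_of (tiling_of h g) =1 h.
Proof.
case=> _ hlt glt v; rewrite /horizontal_of inE; apply/andP/idP => [[lt]|hv].
  move=> /existsP[w /orP[/andP[hw /eqP/horizontal_domino_inj -> //]|/andP[_ /eqP]]].
  by move/(horizontal_vertical_neq lt).
by split; [exact: hlt|apply/existsP; exists v; rewrite hv eqxx].
Qed.

Lemma vertical_of_tiling_of h g :
  exact_cover h g -> vertical_of (tiling_of h g) =1 g.
Proof.
case=> _ hlt glt v; rewrite /vertical_of inE; apply/andP/idP => [[lt]|gv].
  move=> /existsP[w /orP[/andP[/hlt hw /eqP/esym]|/andP[gw /eqP/vertical_domino_inj -> //]]].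
  by move/(horizontal_vertical_neq hw).
by split; [exact: glt|apply/existsP; exists v; rewrite gv eqxx orbT].
Qed.

Lemma tilingK P :
  domino_tiling P -> tiling_of (horizontal_of P) (vertical_of P) = P.
Proof.
case/andP=> _ /forall_inP domP; apply/setP => D; rewrite inE.
apply/existsP/idP => [[v /orP[]/andP[/andP[_ vP] /eqP ->]//]|DP].
have /is_dominoP[v [[lt DE]|[lt DE]]] := domP _ DP; exists v.
  by rewrite /horizontal_of lt -DE DP eqxx.
by rewrite /vertical_of lt -DE DP eqxx orbT.
Qed.

(** The four summands correspond to the four dominoes that can contain [v]. Covering makes one of
    them true; disjointness and injectivity of the encoding exclude any two. *)
Lemma tiling_exact_cover P :
  domino_tiling P -> exact_cover (horizontal_of P) (vertical_of P).
Proof.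
move=> Pt; have PK := tilingK Pt; have /andP[Ppart _] := Pt.
have /and3P[/eqP covP trP _] := Ppart.
split=> [v|v /andP[]//|v /andP[]//].
have uniqD D D' : D \in P -> D' \in P -> v \in D -> v \in D' -> D = D'.
  move=> DP D'P vD vD'; apply/eqP/negPn/negP => ne.
  by move/trivIsetP: trP => /(_ _ _ DP D'P ne) /disjointFr /(_ vD); rewrite vD'.
have hP w : horizontal_of P w -> horizontal_domino w \in P by case/andP.
have gP w : vertical_of P w -> vertical_domino w \in P by case/andP.
have hlt w : horizontal_of P w -> w.2.+1 < q by case/andP.
have self w : (w \in horizontal_domino w) * (w \in vertical_domino w).
  by rewrite !inE eqxx.
have hmem w : horizontal_pair w v -> v \in horizontal_domino w.
  by rewrite inE => ->; rewrite orbT.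
have vmem w : vertical_pair w v -> v \in vertical_domino w.
  by rewrite inE => ->; rewrite orbT.
have : v \in cover P by rewrite covP inE.
case/bigcupP => D DP vD; rewrite -PK in DP.
have excl D' : D' \in P -> v \in D' -> D' = D.
  by move=> D'P vD'; apply: uniqD => //; rewrite -PK.
have cvD := tiling_ofP DP vD; clear DP vD uniqD.
set b1 := horizontal_of P v; set b2 := [exists w, _]; set b3 := vertical_of P v.
set b4 := [exists w, _].
have e1 : b1 -> v.2.+1 < q /\ D = horizontal_domino v.
  by move=> hv; rewrite hlt // (excl (horizontal_domino v)) ?self ?hP.
have e2 : b2 -> exists w, [/\ w <> v, w.2.+1 < q & D = horizontal_domino w].
  case/existsP=> w /andP[wv hw]; exists w; split; [exact: horizontal_pair_neq|exact: hlt|].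
  by rewrite (excl (horizontal_domino w)) ?hmem ?hP.
have e3 : b3 -> D = vertical_domino v.
  by move=> gv; rewrite (excl (vertical_domino v)) ?self ?gP.
have e4 : b4 -> exists w, w <> v /\ D = vertical_domino w.
  case/existsP=> w /andP[wv gw]; exists w; split; first exact: vertical_pair_neq.
  by rewrite (excl (vertical_domino w)) ?vmem ?gP.
have some : [|| b1, b2, b3 | b4].
  case: cvD => [hv _|w wv hw _|gv _|w wv gw _].
  - by rewrite /b1 hv.
  - by apply/or4P/Or42/existsP; exists w; rewrite wv.
  - by rewrite /b3 gv !orbT.
  - by apply/or4P/Or44/existsP; exists w; rewrite wv.
have n12 : ~~ (b1 && b2).
  apply/negP => /andP[/e1[_ D1] /e2[w [+ _ D2]]]; apply.
  by apply: horizontal_domino_inj; rewrite -D1 -D2.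
have n13 : ~~ (b1 && b3).
  apply/negP => /andP[/e1[lt D1] /e3 D2].
  by apply: (@horizontal_vertical_neq v v) => //; rewrite -D1 -D2.
have n14 : ~~ (b1 && b4).
  apply/negP => /andP[/e1[lt D1] /e4[w [_ D2]]].
  by apply: (@horizontal_vertical_neq v w) => //; rewrite -D1 -D2.
have n23 : ~~ (b2 && b3).
  apply/negP => /andP[/e2[w [_ lt D1]] /e3 D2].
  by apply: (@horizontal_vertical_neq w v) => //; rewrite -D1 -D2.
have n24 : ~~ (b2 && b4).
  apply/negP => /andP[/e2[w [_ lt D1]] /e4[w' [_ D2]]].
  by apply: (@horizontal_vertical_neq w w') => //; rewrite -D1 -D2.
have n34 : ~~ (b3 && b4).
  apply/negP => /andP[/e3 D1 /e4[w [+ D2]]]; apply.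
  by apply: vertical_domino_inj; rewrite -D1 -D2.
move: some n12 n13 n14 n23 n24 n34; clear.
by case: b1; case: b2; case: b3; case: b4.
Qed.
End Tilings.

(** * Tilings read column by column *)

Section Columns.
Local Open Scope nat_scope.
Variables p q : nat.
Notation column := ({set 'I_p} * {set 'I_p})%type.
Implicit Types (v w : cell p q) (P : {set {set cell p q}}) (t : q.-tuple column).

Fixpoint chain (H : {set 'I_p}) (s : seq column) : bool :=
  if s is x :: s' then column_ok H x && chain x.1 s' else H == set0.

Lemma completions_chain (k : nat) (H : {set 'I_p}) :
  completions k H = #|[pred t : k.-tuple column | chain H t]|.
Proof.
elim: k H => [|k IHk] H /=.
  rewrite -sum1_card (eq_bigl (fun t : 0.-tuple column => H == set0)); last first.
    by move=> t; rewrite inE tuple0.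
  by case: (H == set0); [rewrite sum1_card card_tuple|rewrite big_pred0].
rewrite -sum1_card (reindex (fun y : column * k.-tuple column => [tuple of y.1 :: y.2])).
  rewrite (eq_bigl (fun y : column * k.-tuple column =>
                      column_ok H y.1 && chain y.1.1 y.2)) //.
  rewrite -(pair_big_dep (column_ok H) (fun (x : column) (t : k.-tuple column) =>
              chain x.1 t) (fun _ _ => 1)) /=.
  by apply: eq_bigr => x _; rewrite IHk -sum1_card.
exists (fun t : k.+1.-tuple column => (thead t, [tuple of behead t])) => [[x t] _|t _] /=.
  by rewrite theadE; congr pair; apply: val_inj.
by apply: val_inj => /=; rewrite [in RHS](tuple_eta t).
Qed.

(** The list [H :: map fst s] holds the incoming sets, shifted by one against the columns; its entry
    at [size s] is what leaves the last column. *)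
Lemma chainP (x0 : column) (H : {set 'I_p}) (s : seq column) :
  chain H s <->
  (forall b, b < size s -> column_ok (nth set0 (H :: map fst s) b) (nth x0 s b))
  /\ nth set0 (H :: map fst s) (size s) = set0.
Proof.
elim: s H => [|x s IHs] H /=; first by split=> [/eqP|[_ ->]].
split=> [/andP[Hx /IHs[sP lP]]|[sP lP]]; first by split=> // -[|b] //=; exact: sP.
apply/andP; split; first exact: (sP 0).
by apply/IHs; split=> // b ltb; exact: (sP b.+1).
Qed.

Definition tuple_horizontal t : pred (cell p q) :=
  fun v => v.1 \in (tnth t v.2).1.

Definition tuple_vertical t : pred (cell p q) :=
  fun v => v.1 \in (tnth t v.2).2.

Lemma mem_previous t (a : 'I_p) (b : nat) :
  reflect (exists w, [/\ w.1 = a, w.2.+1 = b & tuple_horizontal t w])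
          (a \in nth set0 (set0 :: map fst t) b).
Proof.
apply: (iffP idP) => [|[[a' c] /= [-> <-]]]; last first.
  by rewrite /tuple_horizontal /= (tnth_nth (set0, set0)) (nth_map (set0, set0)) ?size_tuple.
case: b => [|b]; rewrite /= ?inE // => ab.
have lt : b < q.
  by rewrite ltnNge; apply/negP => qb; rewrite nth_default ?size_map ?size_tuple ?inE in ab.
exists (a, Ordinal lt); split=> //.
by rewrite /tuple_horizontal (tnth_nth (set0, set0)) -(nth_map _ set0) ?size_tuple.
Qed.

Lemma exact_cover_chain t :
  exact_cover (tuple_horizontal t) (tuple_vertical t) <-> chain set0 t.
Proof.
have leftE v : (v.1 \in nth set0 (set0 :: map fst t) v.2) =
    [exists w, horizontal_pair w v && tuple_horizontal t w].
  apply/mem_previous/existsP => [[w [wa wb hw]]|[w /andP[/andP[/eqP wa /eqP wb] hw]]].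
    by exists w; rewrite hw /horizontal_pair wa -wb !eqxx.
  by exists w; split=> //; apply: val_inj.
have upE v : below (tnth t v.2).2 v.1 =
    [exists w, vertical_pair w v && tuple_vertical t w].
  apply/belowP/existsP => [[b bt bv]|[w /andP[/andP[/eqP wa /eqP wb] gw]]].
    by exists (b, v.2); rewrite /vertical_pair /= bv !eqxx.
  exists w.1 => //; suff <- : w.2 = v.2 by [].
  exact: val_inj.
rewrite (chainP (set0, set0)) size_tuple; split=> [[cov hlt glt]|[cols lastP]].
  split=> [b lt|]; last first.
    apply/setP => a; rewrite inE; apply/mem_previous => -[w [_ wq /hlt]].
    by rewrite wq ltnn.
  have -> : nth (set0, set0) t b = tnth t (Ordinal lt) by rewrite (tnth_nth (set0, set0)).
  apply/andP; split; last by apply/forall_inP => a /(glt (a, Ordinal lt)).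
  apply/forallP => a; have := cov (a, Ordinal lt).
  by rewrite -leftE -upE /= => <-; rewrite [X in (X + _ + _)%N]addnC.
have col v : column_ok (nth set0 (set0 :: map fst t) v.2) (tnth t v.2).
  by rewrite (tnth_nth (set0, set0)); apply: cols.
split=> [v|v hv|v gv].
- have /andP[/forallP/(_ v.1)/eqP + _] := col v.
  by rewrite -leftE -upE => <-; rewrite [X in (X + _ + _)%N]addnC.
- rewrite ltn_neqAle ltn_ord andbT; apply/eqP => vq.
  have : v.1 \in nth set0 (set0 :: map fst t) q by apply/mem_previous; exists v.
  by rewrite lastP inE.
by have /andP[_ /forall_inP/(_ v.1)] := col v; apply.
Qed.

Definition columns_of P : q.-tuple column :=
  [tuple ([set a | horizontal_of P (a, b)], [set a | vertical_of P (a, b)]) | b < q].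

Lemma tuple_horizontal_columns_of P :
  tuple_horizontal (columns_of P) = horizontal_of P.
Proof.
by apply: boolp.funext => -[a b]; rewrite /tuple_horizontal tnth_mktuple /= inE.
Qed.

Lemma tuple_vertical_columns_of P :
  tuple_vertical (columns_of P) = vertical_of P.
Proof.
by apply: boolp.funext => -[a b]; rewrite /tuple_vertical tnth_mktuple /= inE.
Qed.

Lemma num_domino_tilingsE : num_domino_tilings p q = completions q (set0 : {set 'I_p}).
Proof.
rewrite completions_chain /num_domino_tilings -!sum1_card.
rewrite (reindex_onto (fun t => tiling_of (tuple_horizontal t) (tuple_vertical t))
                      columns_of) /=; last first.
  by move=> P Pt; rewrite tuple_horizontal_columns_of tuple_vertical_columns_of tilingK.
apply: eq_bigl => t; rewrite !inE; apply/andP/idP => [[tt /eqP <-]|/exact_cover_chain ct].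
  apply/exact_cover_chain; rewrite tuple_horizontal_columns_of tuple_vertical_columns_of.
  exact: tiling_exact_cover.
split; first exact: tiling_of_tiling.
apply/eqP/eq_from_tnth => b; rewrite tnth_mktuple [RHS]surjective_pairing.
congr pair; apply/setP => a; rewrite inE.
  exact: horizontal_of_tiling_of.
exact: vertical_of_tiling_of.
Qed.
End Columns.

(** * The folded path matrix *)

(** The start ['X + 1] is the recursion at index 0 with [p_{-1} = p_0], which the truncated
    predecessor in [fold_polyS] expresses. *)
Fixpoint fold_poly (A : comNzRingType) (j : nat) : {poly A} :=
  if j is j'.+1 then
    if j' is j''.+1 then ('X + 2) * fold_poly A j' - fold_poly A j'' else 'X + 1
  else 1.

Lemma fold_polyS (A : comNzRingType) (j : nat) :
  fold_poly A j.+1 = ('X + 2) * fold_poly A j - fold_poly A j.-1.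
Proof. by case: j => //=; ring. Qed.

Definition bidiag_mx (R : nzRingType) (m : nat) : 'M[R]_m :=
  \matrix_(i, j) ((j == i) || (j.+1 == i :> nat))%:R.

Definition fold_mx (R : nzRingType) (m : nat) : 'M[R]_m :=
  bidiag_mx R m *m (bidiag_mx R m)^T.

Lemma row_at_subproof (m : nat) (b : bool) (i : 'I_m) : (b + 2 * i < 2 * m)%N.
Proof. by have := ltn_ord i; case: b; lia. Qed.

Definition row_at (m : nat) (b : bool) (i : 'I_m) : 'I_(2 * m) :=
  Ordinal (row_at_subproof b i).

Lemma sum_row_at (R : nmodType) (m : nat) (F : 'I_(2 * m) -> R) :
  \sum_r F r = \sum_i F (row_at false i) + \sum_i F (row_at true i).
Proof.
pose h (y : bool * 'I_m) := row_at y.1 y.2.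
have half_lt (r : 'I_(2 * m)) : (r./2 < m)%N by have := ltn_ord r; lia.
rewrite (reindex h) /=; last first.
  exists (fun r : 'I_(2 * m) => (odd r, Ordinal (half_lt r))) => [[b i] _|r _].
    congr pair; first by rewrite /=; case: b; lia.
    by apply: val_inj; rewrite /=; case: b; lia.
  by apply: val_inj; rewrite /=; lia.
rewrite -(pair_bigA _ (fun b i => F (row_at b i))) /= big_bool addrC.
by [].
Qed.

Definition half_rows (m : nat) (b : bool) (B : 'M[int]_(2 * m, m)) : 'M[int]_m :=
  \matrix_(i, j) B (row_at b i) j.

Lemma moves_row (e b b' : bool) (i j : nat) :
  moves e (b + 2 * i) (b' + 2 * j) =
    if b == e then
      if b' == e then j == i
      else if b then (j == i) || (j == i.+1) else (j == i) || (j.+1 == i)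
    else (b' == b) && (j == i).
Proof.
rewrite /moves oddD oddM /= addbF.
by case: e; case: b; case: b' => /=; apply/idP/idP; lia.
Qed.

Lemma half_rows_move_mx (m : nat) (e b : bool) (B : 'M[int]_(2 * m, m)) :
  half_rows b (move_mx (2 * m) e *m B) =
    (\matrix_(i, j) (moves e (b + 2 * i) (false + 2 * j))%:R) *m half_rows false B +
    (\matrix_(i, j) (moves e (b + 2 * i) (true + 2 * j))%:R) *m half_rows true B.
Proof.
apply/matrixP => i j; rewrite !mxE sum_row_at.
by congr (_ + _); apply: eq_bigr => k _; rewrite !mxE.
Qed.

Lemma matrix_moves_diag (m : nat) (e b : bool) :
  \matrix_(i < m, j < m) (moves e (b + 2 * i) (b + 2 * j))%:R = 1%:M :> 'M[int]_m.
Proof.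
apply/matrixP => i j; rewrite !mxE moves_row eqxx [i == j]eq_sym.
by case: (b == e).
Qed.

Lemma matrix_moves_stay (m : nat) (e : bool) :
  \matrix_(i < m, j < m) (moves e (~~ e + 2 * i) (e + 2 * j))%:R = 0 :> 'M[int]_m.
Proof. by apply/matrixP => i j; rewrite !mxE moves_row; case: e. Qed.

Lemma half_rows_move_stay (m : nat) (e : bool) (B : 'M[int]_(2 * m, m)) :
  half_rows (~~ e) (move_mx (2 * m) e *m B) = half_rows (~~ e) B.
Proof.
have := matrix_moves_diag m e (~~ e); have := matrix_moves_stay m e.
rewrite half_rows_move_mx; case: e => /= -> ->.
  by rewrite mul1mx mul0mx addr0.
by rewrite mul1mx mul0mx add0r.
Qed.

Lemma half_rows_move_true (m : nat) (B : 'M[int]_(2 * m, m)) :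
  half_rows true (move_mx (2 * m) true *m B) =
    (bidiag_mx int m)^T *m half_rows false B + half_rows true B.
Proof.
rewrite half_rows_move_mx matrix_moves_diag mul1mx; congr (_ *m _ + _).
by apply/matrixP => i j; rewrite !mxE moves_row [i == j]eq_sym [_.+1 == _]eq_sym.
Qed.

Lemma half_rows_move_false (m : nat) (B : 'M[int]_(2 * m, m)) :
  half_rows false (move_mx (2 * m) false *m B) =
    half_rows false B + bidiag_mx int m *m half_rows true B.
Proof.
rewrite half_rows_move_mx matrix_moves_diag mul1mx; congr (_ + _ *m _).
by apply/matrixP => i j; rewrite !mxE moves_row.
Qed.

Lemma half_rows_path_mx0 (m : nat) :
  half_rows false (path_mx m 0) = 1%:M /\ half_rows true (path_mx m 0) = 0.
Proof.
split; apply/matrixP => i j; rewrite !mxE /=.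
  by rewrite add0n eqn_pmul2l.
by case: eqP => //; lia.
Qed.

(** Two columns form one step: the inner factor alters only the odd rows, the outer one only the
    even rows, each through a bidiagonal matrix. *)
Lemma half_rows_path_mxS (m n : nat) :
  let E := half_rows false (path_mx m (2 * n)) in
  let O := half_rows true (path_mx m (2 * n)) in
  let O' := half_rows true (path_mx m (2 * n.+1)) in
  O' = (bidiag_mx int m)^T *m E + O /\
  half_rows false (path_mx m (2 * n.+1)) = E + bidiag_mx int m *m O'.
Proof.
rewrite (_ : (2 * n.+1 = (2 * n).+2)%N) /=; last by lia.
rewrite (_ : odd (2 * n) = false) /=; last by lia.
rewrite (half_rows_move_stay false) half_rows_move_true; split=> //.
by rewrite half_rows_move_false (half_rows_move_stay true) half_rows_move_true.
Qed.

Lemma horner_mx_fold_polyS (R : comNzRingType) (m n : nat) (B : 'M[R]_m.+1) :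
  horner_mx B (fold_poly R n.+1) =
    (B + 2%:M) *m horner_mx B (fold_poly R n) - horner_mx B (fold_poly R n.-1).
Proof.
rewrite fold_polyS rmorphB rmorphM rmorphD /= horner_mx_X rmorph_nat.
by rewrite -scalemx1 scaler_nat.
Qed.

Lemma half_rows_path_mx (m n : nat) :
  half_rows false (path_mx m.+1 (2 * n)) =
    horner_mx (fold_mx int m.+1) (fold_poly int n).
Proof.
suff: half_rows false (path_mx m.+1 (2 * n)) =
        horner_mx (fold_mx int m.+1) (fold_poly int n) /\
      half_rows false (path_mx m.+1 (2 * n.+1)) =
        horner_mx (fold_mx int m.+1) (fold_poly int n.+1) by case.
elim: n => [|n [IH0 IH1]].
  have [E0 O0] := half_rows_path_mx0 m.+1; have [O1 E1] := half_rows_path_mxS m.+1 0.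
  rewrite E1 O1 muln0 E0 O0 /= rmorph1 rmorphD /= horner_mx_X rmorph1.
  by rewrite addr0 mulmx1 addrC.
split=> //; rewrite horner_mx_fold_polyS /= -IH1 -IH0.
have [O1 E1] := half_rows_path_mxS m.+1 n; have [O2 E2] := half_rows_path_mxS m.+1 n.+1.
rewrite E2 O2 mulmxDr mulmxA -/(fold_mx int m.+1) mulmxDl.
(* The odd rows drop out: their contribution is a difference of consecutive even halves, which
   leaves a three-term recursion. *)
have -> : bidiag_mx int m.+1 *m half_rows true (path_mx m.+1 (2 * n.+1)) =
  half_rows false (path_mx m.+1 (2 * n.+1)) - half_rows false (path_mx m.+1 (2 * n)).
  by rewrite E1 addrC addKr.
rewrite mul_scalar_mx scaler_nat mulr2n.
by rewrite addrCA -!addrA.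
Qed.

Lemma num_domino_tilings_det (m n : nat) :
  (num_domino_tilings (2 * m.+1) (2 * n))%:Z =
    \det (horner_mx (fold_mx int m.+1) (fold_poly int n)).
Proof.
rewrite num_domino_tilingsE -half_rows_path_mx.
(* The number of columns is even, so the entering parity is even at the start and nothing covered
   means one path in each even row. *)
have -> : set0 = profile (odd (2 * n)) (even_rows m.+1).
  apply/setP => a; rewrite !inE hit_even_rows (_ : odd (2 * n) = false); last by lia.
  by case: (odd a).
rewrite completions_det ?even_rows_increasing //; congr (\det _).
apply/matrixP => i j; rewrite !mxE ffunE; congr (path_mx _ _ _ _).
exact: val_inj.
Qed.

Lemma sum_delta (A : nzRingType) (m k : nat) (g : nat -> A) :
  \sum_(j < m) (j == k :> nat)%:R * g j = if (k < m)%N then g k else 0.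
Proof.
case: ltnP => [lt|ge].
  rewrite (bigD1 (Ordinal lt)) //= eqxx mul1r big1 ?addr0 // => j.
  by rewrite -val_eqE /= => /negPf ->; rewrite mul0r.
by rewrite big1 // => j _; rewrite ltn_eqF ?mul0r // (leq_trans (ltn_ord j)).
Qed.

(** The free end is index 0, where the diagonal entry is 1 instead of 2; at the other end [f m = 0]
    stands for the missing neighbour. *)
Lemma fold_mx_col (A : nzRingType) (m : nat) (f : nat -> A) :
  f m = 0 ->
  fold_mx A m *m (\col_i f i) =
    \col_i (f i + f i.+1 + (if (0 < i)%N then f i.-1 + f i else 0)).
Proof.
move=> fm0; rewrite /fold_mx -mulmxA.
have -> : (bidiag_mx A m)^T *m (\col_i f i) = \col_i (f i + f i.+1).
  apply/matrixP => i j; rewrite !mxE.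
  have -> : f i + f i.+1 = \sum_(k < m) (k == i :> nat)%:R * f k
                           + \sum_(k < m) (k == i.+1 :> nat)%:R * f k.
    rewrite !sum_delta ltn_ord; congr (_ + _); case: ltnP => // im.
    by rewrite (_ : i.+1 = m) //; have := ltn_ord i; lia.
  rewrite -big_split; apply: eq_bigr => k _; rewrite !mxE /= -mulrDl -natrD.
  congr (_%:R * _); rewrite -!val_eqE /= [i.+1 == k]eq_sym [_ i == _ k]eq_sym.
  by case: (k =P i :> nat) => [->|_] //; rewrite ltn_eqF.
apply/matrixP => i j; rewrite !mxE.
pose g k := f k + f k.+1.
have -> : f i + f i.+1 + (if (0 < i)%N then f i.-1 + f i else 0) =
    \sum_(k < m) (k == i :> nat)%:R * g k
    + (if (0 < i)%N then \sum_(k < m) (k == i.-1 :> nat)%:R * g k else 0).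
  rewrite !sum_delta ltn_ord; congr (_ + _); case: ifP => // i0.
  have -> : (i.-1 < m)%N by exact: leq_ltn_trans (leq_pred i) _.
  by rewrite /g prednK.
have -> : (if (0 < i)%N then \sum_(k < m) (k == i.-1 :> nat)%:R * g k else 0)
   = \sum_(k < m) (k.+1 == i :> nat)%:R * g k.
  case: (nat_of_ord i) => [|i'] /=; last exact: eq_bigr.
  by rewrite big1 // => k _; rewrite mul0r.
rewrite -big_split; apply: eq_bigr => k _; rewrite !mxE /= -mulrDl -natrD.
congr (_%:R * _); rewrite -!val_eqE /=.
by case: (k =P i :> nat) => [->|_] //; rewrite gtn_eqF.
Qed.

(** * Chebyshev polynomials and the folded recursion *)

Lemma horner_fold_polyS (A : comNzRingType) (j : nat) (x : A) :
  (fold_poly A j.+1).[x] = (x + 2) * (fold_poly A j).[x] - (fold_poly A j.-1).[x].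
Proof.
by rewrite fold_polyS hornerD hornerN hornerM hornerD hornerX -[2]/(2%:R) hornerMn hornerC.
Qed.

Lemma horner_chebyshevUSS (A : comNzRingType) (j : nat) (y : A) :
  (chebyshevU A j.+2).[y] =
    2 * y * (chebyshevU A j.+1).[y] - (chebyshevU A j).[y].
Proof. by rewrite [chebyshevU A j.+2]/(_ - _) hornerE hornerM !hornerE. Qed.

Lemma chebyshevU_fold_poly (A : comNzRingType) (n : nat) (y : A) :
  (chebyshevU A (2 * n)).[y] = (-1) ^+ n * (fold_poly A n).[- (4 * y ^+ 2)].
Proof.
have US j := @horner_chebyshevUSS A j y.
(* Recursion in steps of two. With [x = - 4 y^2] its coefficient is [-(x + 2)], and this sign
   produces the power of -1. *)
have US2 j : (chebyshevU A j.+4).[y] =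
    (4 * y ^+ 2 - 2) * (chebyshevU A j.+2).[y] - (chebyshevU A j).[y].
  by rewrite !US; ring.
suff : (chebyshevU A (2 * n)).[y] = (-1) ^+ n * (fold_poly A n).[- (4 * y ^+ 2)] /\
  (chebyshevU A (2 * n.+1)).[y] = (-1) ^+ n.+1 * (fold_poly A n.+1).[- (4 * y ^+ 2)].
  by case.
elim: n => [|n [IH0 IH1]].
  split; first by rewrite /= !hornerE.
  rewrite muln1 (US 0) /= !hornerE; rewrite /=; ring.
split=> //; rewrite (_ : (2 * n.+2 = (2 * n).+4)%N); last by lia.
rewrite US2 -(_ : (2 * n.+1 = (2 * n).+2)%N); last by lia.
rewrite IH0 IH1 (horner_fold_polyS n.+1) -pred_Sn !exprS.
by move: (fold_poly A n.+1).[_] (fold_poly A n).[_] => a b; ring.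
Qed.

Lemma fold_poly_monic_size (A : idomainType) (n : nat) :
  fold_poly A n \is monic /\ size (fold_poly A n) = n.+1.
Proof.
suff: (fold_poly A n \is monic /\ size (fold_poly A n) = n.+1) /\
  (fold_poly A n.+1 \is monic /\ size (fold_poly A n.+1) = n.+2) by case.
have X2 (c : A) : 'X + c%:P \is monic /\ size ('X + c%:P) = 2.
  by rewrite -[c]opprK polyCN monicXsubC size_XsubC.
elim: n => [|n [[m0 s0] [m1 s1]]].
  by split; [rewrite monic1 size_poly1|exact: (X2 1)].
split; rewrite ?m1 ?s1 //.
have [] := X2 2%:R; rewrite polyC_natr => m2 s2.
have sM : size (('X + 2) * fold_poly A n.+1) = n.+3.
  by rewrite size_monicM ?monic_neq0 // s2 s1.
have lt : (size (- fold_poly A n)%R < size (('X + 2%:R) * fold_poly A n.+1)%R)%N.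
  by rewrite sM size_polyN s0.
rewrite (fold_polyS A n.+1) monicE lead_coefDl // size_polyDl // sM.
by rewrite -monicE monicMl.
Qed.

Lemma horner_char_poly (A : comNzRingType) (m : nat) (B : 'M[A]_m) (a : A) :
  (char_poly B).[a] = \det (a%:M - B).
Proof.
rewrite /char_poly -horner_evalE -det_map_mx /char_poly_mx map_mxB /=.
rewrite map_scalar_mx /= horner_evalE hornerX; congr (\det (_ - _)).
by apply/matrixP => i j; rewrite !mxE horner_evalE hornerC.
Qed.

(** * Sandpiles on the grid *)

Section Laplacian.
Variables p q : nat.
Implicit Types (v w : cell p q) (g h : cell p q -> int) (c d : config p q).

(** Reduced Laplacian: functions are extended by 0 to the sink, whose edges enter only through the
    degree 4. *)
Definition laplacian g v : int := 4 * g v - \sum_w (grid_adj v w)%:R * g w.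

Lemma grid_adj_sym v w : grid_adj v w = grid_adj w v.
Proof. by rewrite /grid_adj; lia. Qed.

Lemma grid_adj_irrefl v : grid_adj v v = false.
Proof. by rewrite /grid_adj; lia. Qed.

Lemma laplacianB g h v :
  laplacian (fun w => g w - h w) v = laplacian g v - laplacian h v.
Proof.
rewrite /laplacian mulrBr; under eq_bigr => w _ do rewrite mulrBr.
by rewrite sumrB; ring.
Qed.

Lemma laplacianD g h v :
  laplacian (fun w => g w + h w) v = laplacian g v + laplacian h v.
Proof.
rewrite /laplacian mulrDr; under eq_bigr => w _ do rewrite mulrDr.
by rewrite big_split /=; ring.
Qed.

Lemma laplacianN g v : laplacian (fun w => - g w) v = - laplacian g v.
Proof.
rewrite /laplacian mulrN; under eq_bigr => w _ do rewrite mulrN.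
by rewrite sumrN opprB opprK addrC.
Qed.

Lemma laplacianZ (k : int) g v :
  laplacian (fun w => k * g w) v = k * laplacian g v.
Proof.
rewrite /laplacian mulrBr mulr_sumr mulrCA; congr (_ - _).
by apply: eq_bigr => w _; rewrite mulrCA.
Qed.

Lemma laplacian0 v : laplacian (fun=> 0) v = 0.
Proof. by rewrite /laplacian mulr0 big1 ?subr0 // => w _; rewrite mulr0. Qed.

Lemma eq_laplacian g h : g =1 h -> laplacian g =1 laplacian h.
Proof. by move=> gh v; rewrite /laplacian gh; under eq_bigr => w _ do rewrite gh. Qed.

Lemma laplacian_delta v w :
  laplacian (fun u => (u == v)%:R) w = 4 * (w == v)%:R - (grid_adj v w)%:R.
Proof.
rewrite /laplacian (bigD1 v) //= eqxx mulr1 big1 ?addr0 ?(grid_adj_sym w) //.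
by move=> u /negPf ->; rewrite mulr0.
Qed.

Lemma sum_mul_laplacian_delta g v :
  \sum_w g w * laplacian (fun u => (u == v)%:R) w = laplacian g v.
Proof.
under eq_bigr => w _ do rewrite laplacian_delta mulrBr.
rewrite sumrB; congr (_ - _); last by apply: eq_bigr => w _; rewrite mulrC.
rewrite (bigD1 v) //= eqxx mulr1 (mulrC (g v)) big1 ?addr0 // => w /negPf nwv.
by rewrite nwv !mulr0.
Qed.

Lemma fireE c v w : unstable c v ->
  (fire c v w)%:Z = (c w)%:Z - laplacian (fun u => (u == v)%:R) w.
Proof.
rewrite /unstable sandpile_degreeE laplacian_delta ffunE /= => cv.
case: eqVneq => [->|_]; first by rewrite sandpile_degreeE; lia.
by lia.
Qed.

Definition degree_in (F : {set cell p q}) v : nat := \sum_(w in F) grid_adj v w.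

(** Dhar's criterion: a nonempty set in which every vertex holds fewer grains than its degree within
    the set is forbidden. *)
Definition burnable c : Prop :=
  forall F : {set cell p q}, F != set0 -> exists2 v, v \in F & (degree_in F v <= c v)%N.

Lemma fire_other c v w : w != v -> (fire c v w = c w + grid_adj v w)%N.
Proof. by move=> /negPf nwv; rewrite ffunE nwv subn0. Qed.

(* In a set of vertices that have all fired, the one whose last firing is the
   oldest has since then received a grain from each of its neighbours. *)
Lemma fires_to_inv c d : fires_to c d ->
  exists g : cell p q -> nat,
    [/\ forall v, (d v)%:Z = (c v)%:Z - laplacian (fun w => (g w)%:Z) v,
        forall F : {set cell p q}, F != set0 -> (forall v, v \in F -> (0 < g v)%N) ->
          exists2 v, v \in F & (degree_in F v <= d v)%N
      & forall v, g v = 0%N -> (c v <= d v)%N].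
Proof.
elim=> [|d' v _ [g [dE burn keep]] dv].
  exists (fun=> 0%N); split=> // [v|F /set0Pn[v vF] /(_ v vF)//].
  by rewrite laplacian0 subr0.
exists (fun w => g w + (w == v))%N; split=> [w|F F0 Fg|w].
- rewrite fireE // dE -addrA -opprD; congr (_ - _).
  by rewrite -laplacianD; apply: eq_laplacian => u; rewrite PoszD; case: (u == v).
- have [vF|vF] := boolP (v \in F); last first.
    have [w wF|w wF dw] := burn F F0.
      by have := Fg w wF; case: eqP => [wv|]; [rewrite -wv wF in vF|rewrite addn0].
    exists w => //; rewrite fire_other ?(leq_trans dw) ?leq_addr //.
    by apply: contraNneq vF => <-.
  have [Fv|Fv0] := eqVneq (F :\ v) set0.
    exists v => //; rewrite /degree_in big1 // => w wF.
    have : w \notin F :\ v by rewrite Fv inE.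
    by rewrite !inE wF andbT negbK => /eqP ->; rewrite grid_adj_irrefl.
  have [w|w] := burn _ Fv0.
    by rewrite !inE => /andP[/negPf wv /Fg]; rewrite wv addn0.
  rewrite !inE => /andP[wv wF] dw; exists w => //.
  rewrite fire_other // /degree_in (big_setD1 v) //= grid_adj_sym addnC.
  by rewrite leq_add2r.
case: (eqVneq w v) => [_|wv]; first by rewrite addn1.
by rewrite addn0 fire_other // => /keep cd; rewrite (leq_trans cd) ?leq_addr.
Qed.

Lemma stable_lt c v : stable c -> (c v < 4)%N.
Proof. by move=> /(_ v); rewrite /unstable sandpile_degreeE -ltnNge. Qed.

(** A vertex that never fires never drops below its start. With at least 4 grains everywhere, every
    vertex therefore fires, and the burning property reaches all sets. *)
Lemma fires_to_burnable c d : (forall v, (4 <= c v)%N) -> fires_to c d -> stable d ->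
  burnable d /\ exists g, forall v, (d v)%:Z = (c v)%:Z - laplacian g v.
Proof.
move=> c4 /fires_to_inv[g [dE burn keep]] dst; split; last by eexists.
move=> F F0; apply: burn => // v _; rewrite lt0n; apply/eqP => /keep cd.
by have := stable_lt v dst; rewrite ltnNge (leq_trans (c4 v)).
Qed.

Lemma recurrent_burnable c : recurrent c -> burnable c.
Proof.
case=> cst /(_ [ffun=> 4%N])[b [fires _]].
by have [] := fires_to_burnable _ fires cst; first by move=> v; rewrite !ffunE leq_addr.
Qed.

(* The set where [f] is maximal would be forbidden for [d] if the maximum were
   positive. *)
Lemma stable_burnable_le0 c d f : stable c -> burnable d ->
  (forall v, (d v)%:Z = (c v)%:Z - laplacian f v) -> forall v, f v <= 0.
Proof.
move=> cst burn dE v0.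
have [v1 _ max1] := arg_maxP f (erefl : predT v0).
apply: le_trans (max1 v0 isT) _; rewrite leNgt; apply/negP => f1.
set F := [set w | f w == f v1].
have F0 : F != set0 by apply/set0Pn; exists v1; rewrite inE.
have [v] := burn F F0; rewrite inE => /eqP fv dv.
have degE : (\sum_w (grid_adj v w)%:R * (w \in F)%:R = (degree_in F v)%:R :> int).
  rewrite /degree_in natr_sum [RHS]big_mkcond; apply: eq_bigr => w _.
  by case: (w \in F); rewrite ?mulr1 ?mulr0.
have deg4 : \sum_w (grid_adj v w)%:R <= 4 :> int.
  have := grid_degree_le4 v; rewrite /grid_degree -sum1_card -natr_sum => deg4.
  rewrite (_ : (\sum_w grid_adj v w)%N = (\sum_(w | grid_adj v w) 1)%N) ?ler_nat //.
  by rewrite [RHS]big_mkcond; apply: eq_bigr => w _; case: grid_adj.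
have upper : \sum_w (grid_adj v w)%:R * f w <=
   \sum_w (grid_adj v w)%:R * (f v1 - 1) + (degree_in F v)%:R.
  rewrite -degE -big_split; apply: ler_sum => w _ /=; rewrite -mulrDr.
  rewrite ler_wpM2l ?ler0n //; have := max1 w isT.
  by rewrite inE; case: eqVneq => [->|] /=; lia.
have := dE v; rewrite /laplacian fv; have := stable_lt v cst.
rewrite -mulr_suml in upper; move: upper deg4 dv f1.
set A := \sum_w _; set S := \sum_w _ * _; clear => upper deg4 dv f1 c4 dE.
have : A * (f v1 - 1) <= 4 * (f v1 - 1) by rewrite ler_wpM2r //; lia.
by move: upper; rewrite natz; lia.
Qed.

(** The one-sided bound applies to [f] and to [- f]. That [f] itself vanishes later transfers
    symmetry from configurations to potentials. *)
Lemma stable_burnable_uniq c d f :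
  stable c -> burnable c -> stable d -> burnable d ->
  (forall v, (d v)%:Z = (c v)%:Z - laplacian f v) -> (forall v, f v = 0) /\ c = d.
Proof.
move=> cs cb ds db dE.
have f0 v : f v = 0.
  have f_le := stable_burnable_le0 cs db dE v.
  have : - f v <= 0.
    apply: (stable_burnable_le0 (f := fun w => - f w) ds cb) => w.
    by rewrite dE laplacianN; ring.
  by lia.
split=> //; apply/ffunP => v; apply/eqP; rewrite -eqz_nat dE.
by rewrite (eq_laplacian f0) laplacian0 subr0.
Qed.
End Laplacian.

(** * Stabilization and symmetries of the grid *)

Section Stabilization.
Variables p q : nat.
Implicit Types (v w : cell p q) (g h : cell p q -> int) (c d : config p q).

Lemma grid_adj_natE v w :
  (grid_adj v w : nat) =
    ((w.1 == v.1.+1 :> nat) * (w.2 == v.2 :> nat)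
     + (0 < v.1) * ((w.1 == v.1.-1 :> nat) * (w.2 == v.2 :> nat))
     + (w.1 == v.1 :> nat) * (w.2 == v.2.+1 :> nat)
     + (0 < v.2) * ((w.1 == v.1 :> nat) * (w.2 == v.2.-1 :> nat)))%N.
Proof.
rewrite /grid_adj; move: (nat_of_ord v.1) (nat_of_ord v.2) => a b.
move: (nat_of_ord w.1) (nat_of_ord w.2) => a' b'; rewrite !mulnb; lia.
Qed.

Lemma sum_cell_delta (G : nat -> nat -> int) (a b : nat) :
  \sum_(w : cell p q) ((w.1 == a :> nat)%:R * (w.2 == b :> nat)%:R) * G w.1 w.2
    = if (a < p)%N && (b < q)%N then G a b else 0.
Proof.
rewrite -(pair_bigA _ (fun (i : 'I_p) (j : 'I_q) =>
            (i == a :> nat)%:R * (j == b :> nat)%:R * G i j)) /=.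
transitivity (\sum_(i < p) (i == a :> nat)%:R * (if (b < q)%N then G i b else 0)).
  apply: eq_bigr => i _; rewrite -(sum_delta q b (G i)) mulr_sumr.
  by apply: eq_bigr => j _; rewrite mulrA.
rewrite (sum_delta p a (fun i => if (b < q)%N then G i b else 0)).
by case: (a < p)%N; case: (b < q)%N.
Qed.

Lemma laplacian_natE (G : nat -> nat -> int) v :
  laplacian (fun w => G w.1 w.2) v =
    4 * G v.1 v.2
    - ((if (v.1.+1 < p)%N then G v.1.+1 v.2 else 0)
       + (if (0 < v.1)%N then G v.1.-1 v.2 else 0)
       + (if (v.2.+1 < q)%N then G v.1 v.2.+1 else 0)
       + (if (0 < v.2)%N then G v.1 v.2.-1 else 0)).
Proof.
rewrite /laplacian; congr (_ - _).
under eq_bigr => w _ do rewrite grid_adj_natE !natrD !mulrDl !natrM.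
rewrite !big_split /=; congr (_ + _ + _ + _).
- by rewrite sum_cell_delta ltn_ord andbT.
- under eq_bigr => w _ do rewrite -mulrA.
  rewrite -mulr_sumr sum_cell_delta ltn_ord andbT (leq_ltn_trans (leq_pred _)) //.
  by case: (0 < v.1)%N; rewrite ?mul1r ?mul0r.
- by rewrite sum_cell_delta ltn_ord.
under eq_bigr => w _ do rewrite -mulrA.
rewrite -mulr_sumr sum_cell_delta ltn_ord (leq_ltn_trans (leq_pred _)) //.
by case: (0 < v.2)%N; rewrite ?mul1r ?mul0r.
Qed.

(** A concave parabola with zeros at -1 and [p], just outside the grid; it is invariant under
    reflection of the rows and has second difference -2. *)
Definition bump_at (a : nat) : int := (a.+1)%:Z * (p%:Z - a%:Z).

Definition concave_bump v : int := bump_at v.1.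

Lemma concave_bump_gt0 v : 0 < concave_bump v.
Proof.
by rewrite /concave_bump /bump_at mulr_gt0 // subr_gt0 ltz_nat.
Qed.

(** Across rows the contribution is exactly 2, since the parabola vanishes at the missing
    neighbours. Within a row the bump is constant, so absent neighbours only increase the value. *)
Lemma laplacian_concave_bump v : 1 <= laplacian concave_bump v.
Proof.
rewrite (laplacian_natE (fun a _ => bump_at a)).
have b0 : 0 < bump_at v.1 := concave_bump_gt0 v.
have -> : (if (v.1.+1 < p)%N then bump_at v.1.+1 else 0) = bump_at v.1.+1.
  case: ltnP => // pv; have -> : v.1.+1 = p by apply/anti_leq; rewrite ltn_ord.
  by rewrite /bump_at subrr mulr0.
have -> : (if (0 < v.1)%N then bump_at v.1.-1 else 0) = v.1%:Z * (p%:Z - v.1%:Z + 1).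
  case: (nat_of_ord v.1) => [|a] /=; first by rewrite mul0r.
  by rewrite /bump_at; congr (_ * _); lia.
have s1 : (if (v.2.+1 < q)%N then bump_at v.1 else 0) <= bump_at v.1 by case: ifP; lia.
have s2 : (if (0 < v.2)%N then bump_at v.1 else 0) <= bump_at v.1 by case: ifP; lia.
have conc : 2 * bump_at v.1 - (bump_at v.1.+1 + v.1%:Z * (p%:Z - v.1%:Z + 1)) = 2.
  by rewrite /bump_at; move: (nat_of_ord v.1) => a; rewrite -!natz !mulrSr !natz; ring.
by lia.
Qed.

(** Since the Laplacian is symmetric, firing [v] lowers the nonnegative weight [phi] by the
    Laplacian of the bump at [v], hence by at least 1. *)
Lemma stabilization_exists c : exists d, stabilizes_to c d.
Proof.
pose phi d : int := \sum_v concave_bump v * (d v)%:Z.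
have phi_ge0 d : 0 <= phi d.
  by apply: sumr_ge0 => v _; rewrite mulr_ge0 // ltW ?concave_bump_gt0.
suff main n d : phi d < n%:Z -> fires_to c d -> exists e, stabilizes_to c e.
  apply: (main `|phi c|.+1 c _ (fires_to_refl c)).
  by rewrite -addn1 PoszD gez0_abs // ltrDl.
elim: n d => [|n IHn] d; first by have := phi_ge0 d; lia.
move=> dn cd; have [/forallP dst|] := boolP [forall v, ~~ unstable d v].
  by exists d; split.
rewrite negb_forall => /existsP[v]; rewrite negbK => dv.
apply: (IHn (fire d v)); last exact: fires_to_step.
have -> : phi (fire d v) = phi d - laplacian concave_bump v.
  rewrite -sum_mul_laplacian_delta -sumrB; apply: eq_bigr => w _.
  by rewrite fireE // mulrBr.
by have := laplacian_concave_bump v; lia.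
Qed.

Lemma burnable_stabilization c : (forall v, (4 <= c v)%N) ->
  exists d g, [/\ fires_to c d, stable d, burnable d
                & forall v, (d v)%:Z = (c v)%:Z - laplacian g v].
Proof.
move=> c4; have [d [cd dst]] := stabilization_exists c.
by have [db [g dE]] := fires_to_burnable c4 cd dst; exists d, g; split.
Qed.

Section Automorphism.
Variable s : cell p q -> cell p q.
Hypotheses (sK : involutive s) (s_adj : forall v w, grid_adj (s v) (s w) = grid_adj v w).

Lemma laplacian_comp g v : laplacian (g \o s) v = laplacian g (s v).
Proof.
rewrite /laplacian /=; congr (_ - _); rewrite [RHS](reindex_inj (inv_inj sK)) /=.
by apply: eq_bigr => w _; rewrite s_adj.
Qed.

Lemma stable_comp c : stable c -> stable [ffun v => c (s v)].
Proof. by move=> cst v; rewrite /unstable ffunE !sandpile_degreeE -ltnNge; apply: stable_lt. Qed.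

Lemma burnable_comp c : burnable c -> burnable [ffun v => c (s v)].
Proof.
move=> cb F /set0Pn[v0 v0F].
have Fs0 : s @: F != set0 by apply/set0Pn; exists (s v0); apply: imset_f.
have [_ /imsetP[v vF ->] cv] := cb _ Fs0; exists v => //; rewrite ffunE.
apply: leq_trans cv; rewrite /degree_in big_imset /=; last exact: in2W (inv_inj sK).
by under [leqRHS]eq_bigr => w _ do rewrite s_adj.
Qed.

(** Both [d] and its image under [s] are stable and burnable, and they differ by the Laplacian of
    [g (s v) - g v]; uniqueness gives both conclusions. *)
Lemma stabilization_symmetric c d g :
  (forall v, c (s v) = c v) -> stable d -> burnable d ->
  (forall v, (d v)%:Z = (c v)%:Z - laplacian g v) ->
  (forall v, d (s v) = d v) /\ (forall v, g (s v) = g v).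
Proof.
move=> cs dst db dE.
have [|g0 ds] := stable_burnable_uniq (f := fun v => g (s v) - g v) dst db
  (stable_comp dst) (burnable_comp db).
  move=> v; rewrite ffunE laplacianB (laplacian_comp g) !dE cs; ring.
split=> v; first by have /ffunP/(_ v) := ds; rewrite ffunE.
by have := g0 v; lia.
Qed.
End Automorphism.

Definition symmetric_fun (T : Type) (g : cell p q -> T) : Prop :=
  forall (a : 'I_p) (b : 'I_q), g (a, b) = g (a, rev_ord b) /\ g (a, b) = g (rev_ord a, b).

Lemma stabilization_symmetric_config c d g :
  symmetric_config c -> stable d -> burnable d ->
  (forall v, (d v)%:Z = (c v)%:Z - laplacian g v) ->
  symmetric_config d /\ symmetric_fun g.
Proof.
move=> cs dst db dE.
pose s1 v : cell p q := (v.1, rev_ord v.2); pose s2 v : cell p q := (rev_ord v.1, v.2).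
have s1K : involutive s1 by move=> [a b]; rewrite /s1 /= rev_ordK.
have s2K : involutive s2 by move=> [a b]; rewrite /s2 /= rev_ordK.
have s1_adj v w : grid_adj (s1 v) (s1 w) = grid_adj v w.
  by rewrite /grid_adj /=; have := ltn_ord v.2; have := ltn_ord w.2; lia.
have s2_adj v w : grid_adj (s2 v) (s2 w) = grid_adj v w.
  by rewrite /grid_adj /=; have := ltn_ord v.1; have := ltn_ord w.1; lia.
have cs1 v : c (s1 v) = c v by case: v => a b; have [-> _] := cs a b.
have cs2 v : c (s2 v) = c v by case: v => a b; have [_ ->] := cs a b.
have [d1 g1] := stabilization_symmetric s1K s1_adj cs1 dst db dE.
have [d2 g2] := stabilization_symmetric s2K s2_adj cs2 dst db dE.
split=> a b; split; first by rewrite -(d1 (a, b)).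
- by rewrite -(d2 (a, b)).
- by rewrite -(g1 (a, b)).
by rewrite -(g2 (a, b)).
Qed.
End Stabilization.

(** * Symmetric recurrents as classes modulo an integer matrix *)

Lemma int_unitmx_absz_det (m : nat) (A : 'M[int]_m) :
  A \in unitmx -> `|\det A|%N = 1%N.
Proof. by rewrite unitmxE unfold_in => /orP[]/eqP->. Qed.

(** With [A = L D Q] in Smith form, the class of [x] is the family of residues of the entries of
    [L^-1 x] modulo the invariant factors. *)
Lemma int_coker_finite (m : nat) (A : 'M[int]_m) :
  \det A != 0 ->
  exists (T : finType) (r : 'cV[int]_m -> T),
    [/\ #|T| = `|\det A|%N,
        forall t, exists x, r x = t
      & forall x y, r x = r y <-> exists u, x - y = A *m u].
Proof.
have [L Lu [Q Qu [d _ ->]]] := int_Smith_normal_form A.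
set D := \matrix_(i, j) _.
have DE : D = diag_mx (\row_i d`_i).
  apply/matrixP=> i j; rewrite !mxE.
  by have [->|/eqP nij] := eqVneq i j; rewrite ?eqxx // (_ : _ == _ = false)
    //; apply/negP => /eqP /val_inj.
have detD : \det D = \prod_(i < m) d`_i.
  by rewrite DE det_diag; apply: eq_bigr => i _; rewrite mxE ?mxE.
rewrite !det_mulmx !mulf_eq0 !negb_or detD => /andP[/andP[_ /prodf_neq0 dn0] _].
(* The invariant factors are nonzero, so [.-1.+1] leaves their absolute values unchanged; it gives
   the successor form that [inord] needs. *)
pose rT (i : 'I_m) : finType := 'I_(`|d`_i|.-1.+1).
pose T : finType := {dffun forall i : 'I_m, rT i : finType}.
pose r (x : 'cV[int]_m) : T :=
  [ffun i => inord `|((invmx L *m x) i ord0 %% d`_i)%Z|%N : rT i].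
have dgt0 (i : 'I_m) : (0 < `|(d`_i)%R|)%N by rewrite absz_gt0 dn0.
exists T, r; split.
- rewrite card_dep_ffun foldrE big_map big_enum /= !abszM.
  rewrite int_unitmx_absz_det // (int_unitmx_absz_det Qu) mul1n muln1.
  rewrite (big_morph absz abszM (erefl : `|1%:Z|%N = 1%N)).
  by apply: eq_bigr => i _; rewrite card_ord prednK.
- move=> t; exists (L *m \col_i (t i : nat)%:Z).
  apply/ffunP => i; apply/val_inj; rewrite ffunE mulKmx // mxE ?mxE.
  have lti : (t i < `|(d`_i)%R|)%N by rewrite -[X in (_ < X)%N]prednK.
  rewrite -modz_abs modz_small ?lez_nat ?ltz_nat ?lti //.
  by rewrite absz_nat inord_val.
have subE (a b : 'cV[int]_m) k : (a - b) k ord0 = a k ord0 - b k ord0.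
  by rewrite !mxE.
move=> x y; split.
- move=> rxy.
  have eqi (i : 'I_m) : (((invmx L *m x) i ord0) = ((invmx L *m y) i ord0) %[mod d`_i])%Z.
    have /(congr1 (fun t : T => nat_of_ord (t i))) := rxy.
    have lt z : (absz (z %% (d`_i)%R)%Z < (absz (d`_i)%R).-1.+1)%N.
      rewrite prednK // -ltz_nat gez0_abs ?modz_ge0 ?dn0 //.
      by rewrite ltz_mod ?dn0.
    rewrite !ffunE !inordK // => /(congr1 Posz).
    by rewrite !gez0_abs ?modz_ge0 ?dn0.
  pose w := invmx L *m (x - y).
  have dvdw (i : 'I_m) : (d`_i %| w i ord0)%Z.
    by have /eqP := eqi i; rewrite eqz_mod_dvd /w mulmxBr subE.
  exists (invmx Q *m \col_i (w i ord0 %/ d`_i)%Z).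
  rewrite -!mulmxA (mulmxA Q) mulmxV // mul1mx.
  rewrite -[LHS](mulKVmx Lu) -/w; congr (_ *m _).
  clearbody w; apply/matrixP => i j.
  by rewrite ord1 DE mul_diag_mx !mxE mulrC divzK.
- move=> [u xy]; apply/ffunP => i; rewrite !ffunE; congr (inord `|_|%N : rT i).
  apply/eqP; rewrite eqz_mod_dvd.
  have -> : (invmx L *m x) i ord0 - (invmx L *m y) i ord0
            = (invmx L *m (x - y)) i ord0 by rewrite mulmxBr subE.
  by rewrite xy -!mulmxA mulKmx // DE mul_diag_mx mxE mxE dvdz_mulr.
Qed.

(** * Elimination of all columns but one *)

Section Elimination.
Variables (A : comNzRingType) (m : nat).
Notation B := (fold_mx A m.+1).
Implicit Types X F : nat -> 'cV[A]_m.+1.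

(** At [j = 0] the truncation [j.-1] is the mirror: the column across the axis is a copy of column
    0. *)
Definition fold_step F (j : nat) : 'cV[A]_m.+1 :=
  (B + 2%:M) *m F j - F j.-1 - F j.+1.

(** Minus the solution of [X j = fold_step F j] that starts from [F 0 = 0]. *)
Fixpoint eliminate X (j : nat) : 'cV[A]_m.+1 :=
  if j is j'.+1 then
    if j' is j''.+1 then (B + 2%:M) *m eliminate X j' - eliminate X j'' + X j'
    else X 0%N
  else 0.

Lemma eliminateS X (j : nat) :
  eliminate X j.+1 = (B + 2%:M) *m eliminate X j - eliminate X j.-1 + X j.
Proof. by case: j => //=; rewrite mulmx0 subr0 add0r. Qed.

Lemma eliminateB X Y (j : nat) :
  eliminate (fun k => X k - Y k) j = eliminate X j - eliminate Y j.
Proof.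
suff : eliminate (fun k => X k - Y k) j = eliminate X j - eliminate Y j /\
  eliminate (fun k => X k - Y k) j.+1 = eliminate X j.+1 - eliminate Y j.+1 by case.
elim: j => [|j [IH0 IH1]]; first by rewrite /= subr0.
split=> //; rewrite (eliminateS _ j.+1) IH1 -pred_Sn IH0 !(eliminateS _ j.+1) -!pred_Sn.
rewrite mulmxBr; move: (_ *m _) (_ *m _) (eliminate X j) (eliminate Y j) => a b x y.
by apply/matrixP => i k; rewrite !mxE; ring.
Qed.

(** Each equation gives the next column from the previous ones, so [F] is determined by [u = F 0],
    as [p_j(B) u] minus the particular term. The end condition [F n = 0] is all that remains. *)
Lemma fold_step_image X (n : nat) :
  (exists F, F n = 0 /\ forall j, (j < n)%N -> X j = fold_step F j) <->
  (exists u, eliminate X n = horner_mx B (fold_poly A n) *m u).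
Proof.
split=> [[F [Fn XE]]|[u Xu]].
  have [u u0] : exists u, u = F 0%N by exists (F 0%N).
  have FE j : (j <= n)%N -> F j = horner_mx B (fold_poly A j) *m u - eliminate X j.
    elim/ltn_ind: j => -[|j] IH jn; first by rewrite /= rmorph1 mul1mx subr0.
    have -> : F j.+1 = (B + 2%:M) *m F j - F j.-1 - X j.
      by rewrite XE // /fold_step opprD addrA subrr add0r opprK.
    have Fj := IH j (ltnSn j) (ltnW jn).
    have Fp := IH j.-1 (leq_ltn_trans (leq_pred j) (ltnSn j))
                 (leq_trans (leq_pred j) (ltnW jn)).
    rewrite eliminateS horner_mx_fold_polyS Fp Fj mulmxBr mulmxBl -mulmxA.
    move: ((B + 2%:M) *m (_ *m u)) => a; move: ((B + 2%:M) *m _) => b.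
    move: (_ *m u) (eliminate _ _) => c d.
    by apply/matrixP => i k; rewrite !mxE; ring.
  by exists u; have := FE n (leqnn n); rewrite Fn => /esym/eqP; rewrite subr_eq0 => /eqP.
exists (fun j => horner_mx B (fold_poly A j) *m u - eliminate X j).
split=> [|j jn]; first by rewrite Xu subrr.
rewrite /fold_step eliminateS horner_mx_fold_polyS mulmxBr mulmxBl -mulmxA.
move: ((B + 2%:M) *m (_ *m u)) => a; move: ((B + 2%:M) *m _) => b.
    move: (_ *m u) (eliminate _ _) => c d.
by apply/matrixP => i k; rewrite !mxE; ring.
Qed.

Lemma eliminate_single (n : nat) (y : 'cV[A]_m.+1) :
  eliminate (fun j => if j == n then y else 0) n.+1 = y.
Proof.
have e0 j : (j <= n)%N -> eliminate (fun j => if j == n then y else 0) j = 0.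
  elim/ltn_ind: j => -[|j] IH jn //.
  rewrite eliminateS (IH j (ltnSn j) (ltnW jn)).
  rewrite (IH j.-1 (leq_ltn_trans (leq_pred j) (ltnSn j))); last first.
    exact: leq_trans (leq_pred j) (ltnW jn).
  by rewrite mulmx0 subr0 add0r ltn_eqF.
by rewrite eliminateS (e0 n) // (e0 n.-1) ?leq_pred // eqxx mulmx0 subr0 add0r.
Qed.
End Elimination.

(** * Folding along both axes *)

Section Folding.
Variables m n : nat.
Notation cell22 := (cell (2 * m) (2 * n)).

(** Distance to the axis: 0 on the two central lines, [k - 1] on the border. *)
Definition fold_index (k a : nat) : nat := if (a < k)%N then (k - a.+1)%N else (a - k)%N.

Lemma fold_index_lt (k a : nat) : (a < 2 * k)%N -> (fold_index k a < k)%N.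
Proof. by move=> ak; rewrite /fold_index; case: ifP => ?; lia. Qed.

Lemma fold_index_rev (k a : nat) : (a < 2 * k)%N ->
  fold_index k (2 * k - a.+1) = fold_index k a.
Proof. by move=> ak; rewrite /fold_index; case: ifP => ?; case: ifP => ?; lia. Qed.

Lemma fold_index_add (k i : nat) : fold_index k (k + i) = i.
Proof. by rewrite /fold_index; case: ltnP => ?; lia. Qed.

(** Beyond the border the index would be [k], where [f] vanishes. Across the axis the neighbour has
    index 0 again, which [.-1] reproduces. *)
Lemma fold_index_neighbours (k a : nat) (f : nat -> int) : (a < 2 * k)%N -> f k = 0 ->
  (if (a.+1 < 2 * k)%N then f (fold_index k a.+1) else 0)
  + (if (0 < a)%N then f (fold_index k a.-1) else 0)
  = f (fold_index k a).+1 + f (fold_index k a).-1.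
Proof.
move=> ak fk; rewrite /fold_index.
have [lt|ge] := ltnP a k.
  have -> : (a.+1 < 2 * k)%N by lia.
  have -> : (a.-1 < k)%N by lia.
  rewrite addrC; congr (_ + _).
    case: ifP => a0; first by congr f; lia.
    by rewrite -fk; congr f; lia.
  by case: ltnP => ?; congr f; lia.
have -> : (a.+1 < k)%N = false by lia.
have -> : (0 < a)%N by lia.
congr (_ + _); last by case: ltnP => ?; congr f; lia.
case: ltnP => ?; first by congr f; lia.
by rewrite -[LHS]fk; congr f; lia.
Qed.

Definition unfolding (F : nat -> nat -> int) : cell22 -> int :=
  fun v => F (fold_index m v.1) (fold_index n v.2).

Lemma unfolding_symmetric (F : nat -> nat -> int) : symmetric_fun (unfolding F).
Proof.
move=> a b; rewrite /unfolding /=.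
by rewrite !fold_index_rev ?ltn_ord.
Qed.

Lemma laplacian_unfolding (F : nat -> nat -> int) (v : cell22) :
  (forall j, F m j = 0) -> (forall i, F i n = 0) ->
  let i := fold_index m v.1 in let j := fold_index n v.2 in
  laplacian (unfolding F) v =
    4 * F i j - (F i.+1 j + F i.-1 j + (F i j.+1 + F i j.-1)).
Proof.
move=> Fm Fn i j.
rewrite (laplacian_natE (fun a b => F (fold_index m a) (fold_index n b))).
rewrite -[in LHS]addrA (fold_index_neighbours (f := F ^~ _)) ?ltn_ord //.
by rewrite (fold_index_neighbours (f := F _)) ?ltn_ord.
Qed.

(** The default 0 outside the grid is the boundary condition of the folded function. *)
Definition quarter (x : cell22 -> int) (i j : nat) : int :=
  if insub (m + i)%N is Some a then
    if insub (n + j)%N is Some b then x (a, b) else 0 else 0.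

Lemma quarter_ord (x : cell22 -> int) (a : 'I_(2 * m)) (b : 'I_(2 * n)) (i j : nat) :
  (m + i = a)%N -> (n + j = b)%N -> quarter x i j = x (a, b).
Proof.
by rewrite /quarter => -> ->; rewrite !insubT ?ltn_ord // => la lb;
   congr x; congr pair; apply: val_inj.
Qed.

Lemma quarter_row0 (x : cell22 -> int) (j : nat) : quarter x m j = 0.
Proof. by rewrite /quarter insubF //; lia. Qed.

Lemma quarter_col0 (x : cell22 -> int) (i : nat) : quarter x i n = 0.
Proof. by rewrite /quarter; case: insub => // a; rewrite insubF //; lia. Qed.

Lemma quarterB (x y : cell22 -> int) (i j : nat) :
  quarter (fun v => x v - y v) i j = quarter x i j - quarter y i j.
Proof. by rewrite /quarter; case: insub => [a|]; [case: insub => [b|]|]; rewrite ?subr0. Qed.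

Lemma unfolding_quarter (x : cell22 -> int) :
  symmetric_fun x -> unfolding (quarter x) =1 x.
Proof.
move=> xs [a b]; rewrite /unfolding /=.
have [la lb] := (ltn_ord a, ltn_ord b).
rewrite /fold_index; case: ltnP => ha; case: ltnP => hb.
- rewrite (xs a b).2 (xs _ b).1; apply: quarter_ord => /=; lia.
- rewrite (xs a b).2; apply: quarter_ord => /=; lia.
- rewrite (xs a b).1; apply: quarter_ord => /=; lia.
- apply: quarter_ord => /=; lia.
Qed.
End Folding.

(** * Symmetric recurrents and the cokernel *)

Section Classes.
Variables m n : nat.
Notation cells := (cell (2 * m.+1) (2 * n.+1)).
Notation sandpiles := (config (2 * m.+1) (2 * n.+1)).
Implicit Types (x y g : cells -> int) (c d : sandpiles).

(* The signs turn the off-diagonal entries -1 of the folded Laplacian into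
   the +1 of [fold_mx]. *)
Definition signed_columns (F : nat -> nat -> int) (j : nat) : 'cV[int]_m.+1 :=
  \col_i ((-1) ^+ i * F i j).

Definition signed_entries (F : nat -> 'cV[int]_m.+1) (i j : nat) : int :=
  if insub i is Some k then (-1) ^+ i * F j k ord0 else 0.

Lemma fold_step_signed_columns (F : nat -> nat -> int) (j : nat) :
  (forall j, F m.+1 j = 0) ->
  fold_step (signed_columns F) j =
    \col_i ((-1) ^+ i * (4 * F i j - (F i.+1 j + F i.-1 j + (F i j.+1 + F i j.-1)))).
Proof.
move=> F0; rewrite /fold_step mulmxDl.
rewrite (fold_mx_col (f := fun i => (-1) ^+ i * F i j)) ?F0 ?mulr0 //.
apply/matrixP => i k; rewrite mul_scalar_mx !mxE.
case: (nat_of_ord i) => [|l] /=; first by rewrite expr1 expr0; ring.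
by rewrite !exprS; ring.
Qed.

Lemma signed_columns_entries (F : nat -> 'cV[int]_m.+1) (j : nat) :
  signed_columns (signed_entries F) j = F j.
Proof.
apply/matrixP => i k; rewrite !mxE ord1 /signed_entries (valK i).
by rewrite mulrA -expr2 sqrr_sign mul1r.
Qed.

Lemma signed_columnsB (F G : nat -> nat -> int) (j : nat) :
  signed_columns F j - signed_columns G j = signed_columns (fun i j => F i j - G i j) j.
Proof. by apply/matrixP => i k; rewrite !mxE mulrBr. Qed.

Definition column_class x : 'cV[int]_m.+1 :=
  eliminate (signed_columns (quarter x)) n.+1.

Notation P := (horner_mx (fold_mx int m.+1) (fold_poly int n.+1)).

Lemma eq_eliminate (A : comNzRingType) (k : nat) (X Y : nat -> 'cV[A]_k.+1) (j : nat) :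
  (forall i, X i = Y i) -> eliminate X j = eliminate Y j.
Proof.
move=> XY; elim/ltn_ind: j => -[|j] IH //.
by rewrite !eliminateS !IH ?XY // (leq_ltn_trans (leq_pred _)).
Qed.

Lemma laplacian_quarter g (i j : nat) (lti : (i < m.+1)%N) (ltj : (j < n.+1)%N) :
  symmetric_fun g ->
  let F := quarter g in
  quarter (laplacian g) i j =
    4 * F i j - (F i.+1 j + F i.-1 j + (F i j.+1 + F i j.-1)).
Proof.
move=> gs F.
have la : (m.+1 + i < 2 * m.+1)%N by lia.
have lb : (n.+1 + j < 2 * n.+1)%N by lia.
rewrite (quarter_ord _ (a := Ordinal la) (b := Ordinal lb)) //.
rewrite -(eq_laplacian (unfolding_quarter gs)) laplacian_unfolding /= ?fold_index_add //.
- exact: quarter_row0.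
exact: quarter_col0.
Qed.

Lemma laplacian_symmetric g : symmetric_fun g -> symmetric_fun (laplacian g).
Proof.
move=> gs a b; rewrite -!(eq_laplacian (unfolding_quarter gs)).
rewrite !laplacian_unfolding /=; try exact: quarter_row0; try exact: quarter_col0.
by rewrite !fold_index_rev ?ltn_ord.
Qed.

(** Symmetric functions correspond to functions on a quarter that vanish just beyond the border.
    There, after the change of signs, the Laplacian equation is [fold_step] column by column. *)
Lemma column_class_eq x y : symmetric_fun x -> symmetric_fun y ->
  (exists2 g, symmetric_fun g & forall v, x v - y v = laplacian g v) <->
  (exists u, column_class x - column_class y = P *m u).
Proof.
move=> xs ys.
rewrite /column_class -eliminateB -fold_step_image; split.
  case=> g gs xyE; exists (signed_columns (quarter g)); split.
    by apply/matrixP => i k; rewrite !mxE quarter_col0 mulr0.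
  move=> j jn; rewrite fold_step_signed_columns; last exact: quarter_row0.
  rewrite signed_columnsB; apply/matrixP => i k; rewrite !mxE -quarterB.
  rewrite -(laplacian_quarter _ jn gs) //; congr (_ * _).
  by rewrite /quarter; case: insub => // a; case: insub.
case=> F [Fn FE]; pose E := signed_entries F.
have E_row j : E m.+1 j = 0 by rewrite /E /signed_entries insubF ?ltnn.
have E_col i : E i n.+1 = 0.
  by rewrite /E /signed_entries; case: insub => // k; rewrite Fn mxE mulr0.
exists (unfolding E); first exact: unfolding_symmetric.
move=> v; rewrite laplacian_unfolding //.
rewrite -(unfolding_quarter xs) -(unfolding_quarter ys) /unfolding.
have ji : (fold_index m.+1 v.1 < m.+1)%N by rewrite fold_index_lt.
have jn : (fold_index n.+1 v.2 < n.+1)%N by rewrite fold_index_lt.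
move: ji jn; move: (fold_index m.+1 _) (fold_index n.+1 _) => i j ji jn.
have := FE j jn; rewrite signed_columnsB.
have -> : fold_step F j = fold_step (signed_columns E) j.
  by rewrite /fold_step !signed_columns_entries.
rewrite fold_step_signed_columns // => /matrixP/(_ (Ordinal ji) ord0).
have s0 : (-1) ^+ i != 0 :> int by rewrite signr_eq0.
by rewrite !mxE /= => /(mulfI s0).
Qed.

(** Data supported on the outermost column pass through the elimination unchanged, so every vector
    is reached. *)
Lemma column_class_surj (y : 'cV[int]_m.+1) :
  exists2 x, symmetric_fun x & column_class x = y.
Proof.
pose F := signed_entries (fun j => if j == n then y else 0).
exists (unfolding F); first exact: unfolding_symmetric.
rewrite /column_class.
rewrite -[RHS](eliminate_single n y).
have quarterE i j : (i < m.+1)%N -> (j < n.+1)%N -> quarter (@unfolding m.+1 n.+1 F) i j = F i j.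
  move=> im jn; have la : (m.+1 + i < 2 * m.+1)%N by lia.
  have lb : (n.+1 + j < 2 * n.+1)%N by lia.
  rewrite (quarter_ord _ (a := Ordinal la) (b := Ordinal lb)) //.
  by rewrite /unfolding /= !fold_index_add.
apply: eq_eliminate => j; rewrite -[RHS](signed_columns_entries (fun j => if j == n then y else 0) j) -/F.
apply/matrixP => i k; rewrite !mxE; congr (_ * _).
have [jn|nj] := ltnP j n.+1; first by rewrite quarterE.
rewrite /F /signed_entries gtn_eqF //.
have -> : quarter (@unfolding m.+1 n.+1 F) i j = 0.
  by rewrite /quarter; case: insub => // a; rewrite insubF //; lia.
by case: insub => // a; rewrite mxE mulr0.
Qed.

Lemma symmetric_config_fun c : symmetric_config c ->
  symmetric_fun (fun v => (c v)%:Z).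
Proof. by move=> cs a b; have [<- <-] := cs a b. Qed.

Lemma concave_bump_symmetric : symmetric_fun (@concave_bump (2 * m.+1) (2 * n.+1)).
Proof.
move=> a b; rewrite /concave_bump /bump_at /=; split=> //.
by have lt := ltn_ord a; rewrite mulrC; congr (_ * _); lia.
Qed.

(** The Laplacian of the bump is symmetric and at least 1 everywhere, so a large multiple of it
    lifts [x] above any bound within its class. *)
Lemma symmetric_large x (a : cells -> nat) : symmetric_fun x ->
  exists c, [/\ symmetric_config c, forall v, (a v <= c v)%N
    & exists2 g, symmetric_fun g & forall v, (c v)%:Z - x v = laplacian g v].
Proof.
move=> xs; pose K := (\sum_v (a v + `|x v|))%N.
pose h : cells -> int := @concave_bump (2 * m.+1) (2 * n.+1).
pose z v := x v + K%:Z * laplacian h v.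
have az v : (a v)%:Z <= z v.
  have leK : (a v + `|x v| <= K)%N by rewrite /K (bigD1 v) //= leq_addr.
  have : K%:Z <= K%:Z * laplacian h v.
    by rewrite ler_peMr // laplacian_concave_bump.
  by rewrite /z; lia.
have zs : symmetric_fun z.
  move=> i j; have [e1 e2] := xs i j.
  have [e3 e4] := laplacian_symmetric concave_bump_symmetric i j.
  by rewrite /z -e1 -e2 /h -e3 -e4.
exists [ffun v => `|z v|%N]; have cE v : `|z v|%N = z v :> int.
  by rewrite gez0_abs // (le_trans _ (az v)).
split=> [i j|v|].
- by rewrite !ffunE; have [<- <-] := zs i j.
- by rewrite ffunE -lez_nat cE.
exists (fun v => K%:Z * h v) => [i j|v].
  by rewrite /h; have [<- <-] := concave_bump_symmetric i j.
by rewrite ffunE cE laplacianZ /z addrC addKr.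
Qed.

(** A symmetric configuration above [a + 4] in the class of [c] stabilizes to a stable burnable one,
    which is [c] by uniqueness. *)
Lemma symmetric_recurrent_stable_burnable c :
  symmetric_config c -> stable c -> burnable c -> symmetric_recurrent c.
Proof.
move=> cs cst cb; split=> //; split=> // a.
have [z [zs az [g gs zE]]] :=
  symmetric_large (fun v => (a v + 4)%N) (symmetric_config_fun cs).
have z4 v : (4 <= z v)%N by rewrite (leq_trans _ (az v)) ?leq_addl.
have [d [h [zd dst db dE]]] := burnable_stabilization z4.
exists [ffun v => (z v - a v)%N].
have -> : add_config a [ffun v => (z v - a v)%N] = z.
  by apply/ffunP => v; rewrite !ffunE subnKC // (leq_trans (leq_addr _ _) (az v)).
suff [_ ->] : (forall v, h v - g v = 0) /\ c = d by split.
apply: stable_burnable_uniq => // v.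
by rewrite laplacianB dE -zE; ring.
Qed.

Lemma symmetric_recurrent_class_bij : \det P != 0 ->
  exists f : sandpiles -> 'I_`|\det P|,
    [/\ forall c d, symmetric_recurrent c -> symmetric_recurrent d -> f c = f d -> c = d
      & forall t, exists2 c, symmetric_recurrent c & f c = t].
Proof.
move=> /int_coker_finite[T [r [cardT r_surj rE]]].
pose f c := cast_ord cardT (enum_rank (r (column_class (fun v => (c v)%:Z)))).
exists f; split=> [c d [cr cs] [dr ds]|t].
  move=> /cast_ord_inj/enum_rank_inj/rE/column_class_eq.
  case=> [||g _ cdE]; try exact: symmetric_config_fun.
  have [_ //] : (forall v, g v = 0) /\ c = d.
  apply: stable_burnable_uniq; try exact: recurrent_burnable.
  - by case: cr.
  - by case: dr.
  by move=> v; rewrite -cdE; ring.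
have [y yt] := r_surj (enum_val (cast_ord (esym cardT) t)).
have [x xs xy] := column_class_surj y.
have [z [zs az [g gs zE]]] := symmetric_large (fun=> 4%N) xs.
have [d [h [zd dst db dE]]] := burnable_stabilization az.
(* The potential [h] is symmetric together with [d], so stabilizing preserves the class modulo
   Laplacians of symmetric functions. *)
have [ds hs] := stabilization_symmetric_config zs dst db dE.
exists d; first exact: symmetric_recurrent_stable_burnable.
suff eqr : r (column_class (fun v => (d v)%:Z)) = r y.
  by rewrite /f eqr yt enum_valK cast_ordKV.
apply/rE; rewrite -xy; apply/column_class_eq => //; first exact: symmetric_config_fun.
exists (fun v => g v - h v) => [a b|v].
  by have [<- <-] := gs a b; have [<- <-] := hs a b.
by rewrite laplacianB dE -zE; ring.
Qed.
End Classes.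

(** * Trigonometric products *)

From mathcomp Require Import all_classical all_reals all_analysis.
From mathcomp Require Import complex.
Import Order.TTheory GRing.Theory Num.Theory.

Section Spectrum.
Variable R : realType.

Lemma chebyshevU_cos (j : nat) (t : R) :
  (chebyshevU R j).[cos t] * sin t = sin (j.+1%:R * t).
Proof.
suff : (chebyshevU R j).[cos t] * sin t = sin (j.+1%:R * t) /\
       (chebyshevU R j.+1).[cos t] * sin t = sin (j.+2%:R * t) by case.
elim: j => [|j [IH0 IH1]].
  split; first by rewrite /= hornerC !mul1r.
  have -> : 2%:R * t = t + t by ring.
  by rewrite sinD /= hornerZ hornerX; ring.
split=> //; rewrite horner_chebyshevUSS mulrBl -(mulrA _ _ (sin t)) IH1 IH0.
have -> : j.+3%:R * t = j.+2%:R * t + t by rewrite -[in LHS]addn1 natrD mulrDl mul1r.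
have -> : j.+1%:R * t = j.+2%:R * t - t.
  by rewrite -[in RHS]addn1 natrD mulrDl mul1r addrK.
by rewrite sinB sinD; ring.
Qed.

Lemma xiE (h d : nat) : xi R h d = cos (h%:R * pi / (2 * d + 1)%:R).
Proof. by []. Qed.

(** In the open first quadrant the cosine is positive and injective, which makes the squares of the
    [xi] distinct. *)
Lemma xi_angle (h d : nat) : (0 < h <= d)%N ->
  0 < h%:R * (pi : R) / (2 * d + 1)%:R < (pi : R) / 2.
Proof.
case/andP=> h0 hd; have pi0 := pi_gt0 R.
have d0 : 0 < (2 * d + 1)%:R :> R by rewrite ltr0n addn1.
apply/andP; split; first by rewrite divr_gt0 // mulr_gt0 // ltr0n.
rewrite ltr_pdivrMr // natrD natrM.
have hd' : h%:R <= d%:R :> R by rewrite ler_nat.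
rewrite -subr_ge0 in hd'; have := mulr_ge0 (ltW pi0) hd'.
by lra.
Qed.

Lemma xi_gt0 (h d : nat) : (0 < h <= d)%N -> 0 < xi R h d.
Proof.
move=> /xi_angle /andP[t0 tpi]; rewrite xiE cos_gt0_pihalf // tpi andbT.
by rewrite (lt_trans _ t0) // oppr_lt0 divr_gt0 ?pi_gt0.
Qed.

Lemma xi_inj (h k d : nat) : (0 < h <= d)%N -> (0 < k <= d)%N ->
  xi R h d = xi R k d -> h = k.
Proof.
move=> hd kd; rewrite !xiE.
have pi0 := pi_gt0 R.
have itv l : (0 < l <= d)%N -> l%:R * pi / (2 * d + 1)%:R \in `[0, (pi : R)].
  move=> /xi_angle /andP[t0 tpi]; rewrite in_itv /= ltW //=.
  by rewrite ltW // (lt_trans tpi) // ltr_pdivrMr // ltr_pMr // ltr1n.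
have c0 : (2 * d + 1)%:R^-1 != 0 :> R by rewrite invr_neq0 // pnatr_eq0 addn1.
move/(cos_inj (itv _ hd) (itv _ kd))/(mulIf c0)/(mulIf (lt0r_neq0 pi0))/eqP.
by rewrite eqr_nat => /eqP.
Qed.

(** At [t = k pi / (2n + 1)] the product [U_{2n}(cos t) sin t] equals [sin (k pi) = 0], while
    [sin t] is nonzero. *)
Lemma fold_poly_xi (k n : nat) : (0 < k <= n)%N ->
  (fold_poly R n).[- (4 * xi R k n ^+ 2)] = 0.
Proof.
move=> kn; have /andP[t0 tpi] := xi_angle kn.
set t := _ / _ in t0 tpi.
have st : sin t != 0.
  rewrite gt_eqF // sin_gt0_pi // t0 (lt_trans tpi) //.
  by rewrite ltr_pdivrMr // ltr_pMr ?pi_gt0 // ltr1n.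
apply: (mulfI (x := (-1) ^+ n)); first by rewrite signr_eq0.
rewrite mulr0 -chebyshevU_fold_poly; apply: (mulIf st).
rewrite mul0r xiE -/t chebyshevU_cos /t -addn1 mulrC divfK; last first.
  by rewrite pnatr_eq0 addn1.
elim: (k) => [|l IH]; first by rewrite mul0r sin0.
by rewrite -addn1 natrD mulrDl mul1r sinDpi IH oppr0.
Qed.

Definition fold_roots (n : nat) : seq R := [seq 4 * xi R (k : nat) n ^+ 2 | k : nat <- iota 1 n].

Lemma fold_roots_uniq (n : nat) : uniq (fold_roots n).
Proof.
rewrite map_inj_in_uniq ?iota_uniq // => h k; rewrite !mem_iota => hn kn.
have hn' : (0 < h <= n)%N by lia.
have kn' : (0 < k <= n)%N by lia.
move/(mulfI _) => /(_ _)/eqP; rewrite eqrXn2 ?ltW ?xi_gt0 // => eqxi.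
by apply: (xi_inj hn' kn'); apply/eqP/eqxi; rewrite pnatr_eq0.
Qed.

Lemma fold_poly_factor (n : nat) :
  fold_poly R n = \prod_(c <- fold_roots n) ('X + c%:P).
Proof.
have [mon sz] := fold_poly_monic_size R n.
pose rs := [seq - c | c <- fold_roots n].
have size_rs : size (fold_poly R n) = (size rs).+1 by rewrite sz !size_map size_iota.
have root_rs : all (root (fold_poly R n)) rs.
  apply/allP => _ /mapP[_ /mapP[k kn ->] ->]; rewrite /root fold_poly_xi //.
  by move: kn; rewrite mem_iota; lia.
have uniq_rs : uniq_roots rs.
  by rewrite uniq_rootsE map_inj_uniq ?fold_roots_uniq //; exact: oppr_inj.
rewrite (all_roots_prod_XsubC size_rs root_rs uniq_rs) (monicP mon) scale1r big_map.
by apply: eq_bigr => c _; rewrite polyCN opprK.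
Qed.

(** The recursion of [fold_poly] is the eigenvector equation for the entries [(-1)^i p_i(-a)], and
    the root [p_m(-a) = 0] supplies the fixed end. *)
Lemma fold_mx_eigenvalue (m h : nat) : (0 < h <= m)%N ->
  eigenvalue (fold_mx R m) (4 * xi R h m ^+ 2).
Proof.
move=> hm; set a := 4 * _; have root_a : (fold_poly R m).[- a] = 0 := fold_poly_xi hm.
pose f (i : nat) : R := (-1) ^+ i * (fold_poly R i).[- a].
have fm : f m = 0 by rewrite /f root_a mulr0.
have m0 : (0 < m)%N by lia.
apply/eigenvalueP; exists (\col_i f i)^T; last first.
  apply/eqP => /matrixP/(_ ord0 (Ordinal m0)); rewrite !mxE /f /= expr0 mul1r hornerC.
  by move/eqP; rewrite oner_eq0.
apply: trmx_inj; rewrite trmx_mul !trmxK.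
have -> : (fold_mx R m)^T = fold_mx R m by rewrite /fold_mx trmx_mul trmxK.
rewrite fold_mx_col // linearZ /= trmxK; apply/matrixP => i j; rewrite !mxE.
case: (nat_of_ord i) => [|k] /=.
  by rewrite /f horner_fold_polyS /= !hornerC expr0 expr1; ring.
rewrite /f (horner_fold_polyS k.+1) -pred_Sn !exprS.
by move: (fold_poly R k.+1).[_] (fold_poly R k).[_] => x y; ring.
Qed.

(** The known eigenvalues are distinct and as many as the degree, so they split the characteristic
    polynomial, which is evaluated at [- c]. *)
Lemma det_fold_mx_add (m : nat) (c : R) :
  \det (fold_mx R m + c%:M) = \prod_(a <- fold_roots m) (a + c).
Proof.
have -> : \det (fold_mx R m + c%:M) = (-1) ^+ m * (char_poly (fold_mx R m)).[- c].
  rewrite horner_char_poly -detZ; congr (\det _).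
  by rewrite scaleN1r opprB rmorphN /= opprK.
have size_rs : size (char_poly (fold_mx R m)) = (size (fold_roots m)).+1.
  by rewrite size_char_poly size_map size_iota.
have root_rs : all (root (char_poly (fold_mx R m))) (fold_roots m).
  apply/allP => _ /mapP[k kn ->]; rewrite -eigenvalue_root_char.
  by apply: fold_mx_eigenvalue; move: kn; rewrite mem_iota; lia.
have uniq_rs : uniq_roots (fold_roots m) by rewrite uniq_rootsE fold_roots_uniq.
rewrite (all_roots_prod_XsubC size_rs root_rs uniq_rs).
rewrite (monicP (char_poly_monic _)) scale1r horner_prod.
have -> : (-1) ^+ m = \prod_(a <- fold_roots m) (-1) :> R.
  by rewrite big_const_seq count_predT size_map size_iota iter_mulr_1.
rewrite -big_split /=; apply: eq_bigr => a _.
by rewrite hornerD hornerN hornerX hornerC; ring.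
Qed.

Lemma det_horner_fold (m n : nat) :
  \det (horner_mx (fold_mx R m.+1) (fold_poly R n)) =
    \prod_(a <- fold_roots m.+1) \prod_(c <- fold_roots n) (a + c).
Proof.
rewrite fold_poly_factor rmorph_prod /=.
rewrite (big_morph (fun A : 'M[R]_m.+1 => \det A) (@det_mulmx _ _) (det1 _ _)).
rewrite exchange_big; apply: eq_bigr => c _.
by rewrite rmorphD /= horner_mx_X horner_mx_C det_fold_mx_add.
Qed.
End Spectrum.

(** * Passage from integers to real and complex numbers *)

Lemma map_fold_poly (A A' : comNzRingType) (f : {rmorphism A -> A'}) (n : nat) :
  map_poly f (fold_poly A n) = fold_poly A' n.
Proof.
suff : map_poly f (fold_poly A n) = fold_poly A' n /\
       map_poly f (fold_poly A n.+1) = fold_poly A' n.+1 by case.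
elim: n => [|n [IH0 IH1]]; first by rewrite /= rmorphD /= map_polyX !rmorph1.
split=> //; rewrite !(fold_polyS _ n.+1) rmorphB rmorphM rmorphD /= map_polyX.
by rewrite rmorph_nat IH0 IH1.
Qed.

Lemma map_fold_mx (A A' : nzRingType) (f : {rmorphism A -> A'}) (m : nat) :
  map_mx f (fold_mx A m) = fold_mx A' m.
Proof.
have bE : map_mx f (bidiag_mx A m) = bidiag_mx A' m.
  by apply/matrixP => i j; rewrite !mxE rmorph_nat.
by rewrite /fold_mx map_mxM -map_trmx bE.
Qed.

Lemma big_fold_roots (R : realType) (n : nat) (F : R -> R) :
  \prod_(c <- fold_roots R n) F c = \prod_(1 <= k < n.+1) F (4 * xi R k n ^+ 2).
Proof. by rewrite big_map /index_iota subSS subn0. Qed.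

Lemma num_domino_tilings_prod (R : realType) (m n : nat) :
  (num_domino_tilings (2 * m.+1) (2 * n))%:R =
    \prod_(1 <= h < m.+2) \prod_(1 <= k < n.+1)
       (4 * xi R h m.+1 ^+ 2 + 4 * xi R k n ^+ 2) :> R.
Proof.
rewrite -[LHS]/((Posz _)%:~R) num_domino_tilings_det -(det_map_mx (intmul 1)).
rewrite map_horner_mx map_fold_mx map_fold_poly det_horner_fold big_fold_roots.
by apply: eq_bigr => h _; rewrite big_fold_roots.
Qed.

(** Every factor of the product is positive. This provides the nonzero determinant on which the
    finite cokernel rests. *)
Lemma num_domino_tilings_gt0 (R : realType) (m n : nat) :
  0 < (num_domino_tilings (2 * m.+1) (2 * n))%:R :> R.
Proof.
rewrite num_domino_tilings_prod big_nat prodr_gt0 // => h hm.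
rewrite big_nat prodr_gt0 // => k kn.
by rewrite addr_gt0 // mulr_gt0 // exprn_gt0 // xi_gt0.
Qed.

Lemma horner_fold_poly (R : realType) (n : nat) (x : R) :
  (fold_poly R n).[x] = \prod_(1 <= k < n.+1) (x + 4 * xi R k n ^+ 2).
Proof.
rewrite fold_poly_factor horner_prod big_fold_roots; apply: eq_bigr => k _.
by rewrite hornerD hornerX hornerC.
Qed.

(** At [y = i x] the argument [- 4 y^2] is the real number [4 x^2]. *)
Lemma chebyshevU_imaginary (R : realType) (n : nat) (x : R) :
  (chebyshevU (R[i] : comNzRingType) (2 * n)).['i%C * x%:C%C] =
    (-1) ^+ n * ((fold_poly R n).[4 * x ^+ 2])%:C%C.
Proof.
rewrite chebyshevU_fold_poly; congr (_ * _).
rewrite -(map_fold_poly (real_complex R)) -horner_map /=; congr (_.[_]).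
by rewrite exprMn sqr_i mulN1r mulrN opprK rmorphM rmorphXn rmorph_nat.
Qed.

Unset Implicit Arguments.

Theorem theorem4p2 (R : realType) (m n : nat) (hm : (1 <= m)%N) (hn : (1 <= n)%N) :
  let N := num_domino_tilings (2 * m) (2 * n) in
  [/\ ([set c : config (2 * m) (2 * n) | symmetric_recurrent c] #= `I_N)%classic%card,
      N%:R = (-1) ^+ (m * n) *
             \prod_(1 <= h < m.+1)
                (chebyshevU (R[i] : comNzRingType) (2 * n)).['i%C * (xi R h m)%:C%C]
        :> R[i]
    & N%:R = \prod_(1 <= h < m.+1) \prod_(1 <= k < n.+1)
               (4 * xi R h m ^+ 2 + 4 * xi R k n ^+ 2) :> R].
Proof.
case: m n hm hn => [//|m] [//|n] _ _ N.
have NE := num_domino_tilings_prod R m n.+1.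
have detN := num_domino_tilings_det m n.+1.
split=> //.
- have det0 : \det (horner_mx (fold_mx int m.+1) (fold_poly int n.+1)) != 0.
    by rewrite -detN eqz_nat -lt0n -(ltr0n R) num_domino_tilings_gt0.
  have [f [f_inj f_surj]] := symmetric_recurrent_class_bij det0.
  have cardN : `|\det (horner_mx (fold_mx int m.+1) (fold_poly int n.+1))|%N = N.
    by rewrite -detN absz_nat.
  apply/card_set_bijP; exists (fun c => nat_of_ord (f c)); split.
  + by move=> c _ /=; rewrite -cardN ltn_ord.
  + by move=> c d /set_mem cs /set_mem ds /val_inj; exact: f_inj.
  + move=> k /=; rewrite -cardN => kN.
    by have [c cs fc] := f_surj (Ordinal kN); exists c => //; rewrite fc.
have -> : N%:R = (N%:R : R)%:C%C by rewrite rmorph_nat.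
under eq_bigr => h _ do rewrite chebyshevU_imaginary horner_fold_poly.
(* The signs of the Chebyshev factors multiply to the leading sign, and the two cancel. *)
rewrite big_split /= prodr_const_nat subSS subn0 -exprM mulnC mulrA -expr2 sqrr_sign mul1r.
by rewrite -(rmorph_prod (real_complex R)) NE.
Qed.
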